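(* There is an online bin covering algorithm with advice that, reading $O(\log\log n)$ bits of advice on inputs of length $n$, achieves an asymptotic competitive ratio of at least $8/15$. That is, there is such an algorithm $A$ and a function $b$ with $b(\sigma)\in o(\mathrm{OPT}(\sigma))$ such that for all $n$ and all input sequences $\sigma$ of length at most $n$ there is an advice string $\Phi$ of which $A$ reads $O(\log\log n)$ bits and $A(\sigma)\ge \frac{8}{15}\mathrm{OPT}(\sigma)-b(\sigma)$.
   Context: Bin covering: items with sizes in $(0,1]$ arrive online and each must be irrevocably placed into a bin; a bin is covered if the total size of its items is at least $1$; the goal is to maximize the number of covered bins. In the advice-on-tape model, an oracle with unlimited computational power writes an advice string on a tape beforehand; the algorithm knows the meaning of the advice and its decision for the $i$-th item may depend on the advice and the sizes of the first $i$ items. $A(\sigma)$ is the number of bins covered by $A$ and $\mathrm{OPT}(\sigma)$ the maximum possible number of covered bins for $\sigma$. The asymptotic competitive ratio is defined like the competitive ratio ($A(\sigma)\ge c\cdot\mathrm{OPT}(\sigma)-b$) except that the additive term $b$ may be non-constant as long as it is $o(\mathrm{OPT}(\sigma))$. *)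

(* Defs.v *)
From HB Require Import structures.
From mathcomp Require Import all_boot all_order all_algebra.
From mathcomp Require Import all_classical all_reals all_analysis.

Set Implicit Arguments.
Unset Strict Implicit.
Unset Printing Implicit Defensive.

Import Order.TTheory GRing.Theory Num.Theory.
Import numFieldNormedType.Exports.

Local Open Scope classical_set_scope.
Local Open Scope ring_scope.

Definition valid_input (R : realType) (sigma : seq R) : bool :=
  all (fun x => (0 < x) && (x <= 1)) sigma.

(* A packing of [sigma] is the sequence [bins] of the same length whose i-th
   entry is the label of the bin receiving the i-th item. *)
Definition load (R : realType) (sigma : seq R) (bins : seq nat) (j : nat) : R :=
  \sum_(p <- zip sigma bins | p.2 == j) p.1.

Definition num_covered (R : realType) (sigma : seq R) (bins : seq nat) : nat :=
  count (fun j => 1 <= load sigma bins j) (undup bins).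

(* A packing of n items uses at most n bins and [num_covered] does not depend
   on the names of the bins, so n labels are enough. *)
Definition opt (R : realType) (sigma : seq R) : nat :=
  (\max_(f : (size sigma).-tuple 'I_(size sigma))
     num_covered sigma [seq val j | j <- f])%N.

Variant action : Type := ReadBit | PutIn of nat.

(* [A seen bits] is the next action of [A] while it processes the last item of
   [seen], where [seen] lists the items revealed so far and [bits] the advice
   bits read so far. The algorithm sees neither the length of the input nor any
   bit of the tape that it has not explicitly read. *)
Definition advice_algorithm (R : realType) : Type :=
  seq R -> seq bool -> action.

(* [exec A tape past k rest bins k']: having already packed [past] and read the
   first k bits of the infinite [tape], [A] packs the items [rest], revealed one
   by one, into [bins], and it has then read exactly the first k' bits. There is
   no such execution if [A] reads forever. *)
Inductive exec (R : realType) (A : advice_algorithm R) (tape : nat -> bool) :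
    seq R -> nat -> seq R -> seq nat -> nat -> Prop :=
| exec_end past k :
    exec A tape past k [::] [::] k
| exec_read past k x rest bins k' :
    A (rcons past x) (mkseq tape k) = ReadBit ->
    exec A tape past k.+1 (x :: rest) bins k' ->
    exec A tape past k (x :: rest) bins k'
| exec_put past k x rest j bins k' :
    A (rcons past x) (mkseq tape k) = PutIn j ->
    exec A tape (rcons past x) k rest bins k' ->
    exec A tape past k (x :: rest) (j :: bins) k'.

Definition runs (R : realType) (A : advice_algorithm R) (tape : nat -> bool)
    (sigma : seq R) (bins : seq nat) (k : nat) : Prop :=
  exec A tape [::] 0 sigma bins k.

(* The filter "OPT(sigma) tends to infinity" on input sequences. *)
Definition opt_oo (R : realType) : set_system (seq R) :=
  filter_from setT
    (fun N : nat => [set sigma | valid_input sigma /\ (N <= opt sigma)%N]).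

Arguments opt_oo {R}.

Global Instance opt_oo_filter (R : realType) : Filter (@opt_oo R).
Proof.
apply: filter_fromT_filter; first by exists 0%N.
move=> i j; exists (maxn i j) => sigma /= [Hv].
by rewrite geq_max => /andP[].
Qed.
Canonical opt_oo_filterType (R : realType) := FilterType (@opt_oo R) _.

(* Main.v *)
Require Import Defs.
From HB Require Import structures.
From mathcomp Require Import all_boot all_order all_algebra.
From mathcomp Require Import all_classical all_reals all_analysis.
From mathcomp Require Import lra zify.

Set Implicit Arguments.
Unset Strict Implicit.
Unset Printing Implicit Defensive.

Import Order.TTheory GRing.Theory Num.Theory.
Import numFieldNormedType.Exports.

Local Open Scope classical_set_scope.
Local Open Scope ring_scope.

(** Call an item large if its size is at least 1/2. Among the covered bins of an
    optimal packing let [a] contain two or more large items, [b] exactly one and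
    [c] none. Covering bins greedily with large items only and with small items
    only covers about half the number of large items plus two thirds of the small
    volume, which is enough unless [b] dominates.

    Otherwise the first [q], about [b / 3], large items open bins of their own.
    Small items arriving before the [q]-th large item are spread evenly over [r]
    stock bins, each of which later receives a fitting large item; small items
    arriving afterwards complete the [g] fullest of the [q] bins, and the remaining
    large items are paired. A success covers about half of the number of large
    items plus (r + g) / 2 bins. If neither [r] nor [g] can be enlarged, truncating
    sizes at a suitable threshold gives weights showing that the small items of the
    optimal packing do not suffice for more, whence [r + g] is large enough.

    The advice is [q], [r] and [g] as multiples of a power of two [u]; since the
    loss is O(u), a [u] of order OPT / log OPT makes it o(OPT) while leaving
    multiples of O(log log OPT) bits. *)

(** * Weights and optimal packings *)

Section Packings.
Context (R : realType).
Implicit Types (C s : seq R) (t x y : R).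

Definition large y : bool := 2^-1 <= y.

Definition phi t x : R := Num.min 1 (x / t).

(* A large item [y] needs small items of total size [1 - y], worth at least
   [phi t (1 - y)] by subadditivity, so its bin always has weight at least 1. *)
Definition weight t y : R := if large y then 1 - phi t (1 - y) else phi t y.

Definition content (T : eqType) (Z : seq (R * T)) (l : T) : seq R :=
  [seq p.1 | p <- Z & p.2 == l].

Lemma big_content (T : eqType) (Z : seq (R * T)) l (F : R -> R) :
  \sum_(y <- content Z l) F y = \sum_(p <- Z | p.2 == l) F p.1.
Proof. by rewrite big_map big_filter. Qed.

Lemma sum_content (T : eqType) (Z : seq (R * T)) (L : seq T) (F : R -> R) :
  uniq L -> {in Z, forall p, p.2 \in L} ->
  \sum_(p <- Z) F p.1 = \sum_(l <- L) \sum_(y <- content Z l) F y.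
Proof.
move=> uL; elim: Z => [|p Z IH] ZL.
  by rewrite big_nil big1 // => l _; rewrite big_nil.
rewrite big_cons IH; last by move=> p' p'Z; apply: ZL; rewrite inE p'Z orbT.
have pL : p.2 \in L by apply: ZL; rewrite inE eqxx.
rewrite (perm_big _ (perm_to_rem pL)) [in RHS](perm_big _ (perm_to_rem pL)) /=.
rewrite !big_cons addrA; congr (_ + _).
  by rewrite /content /= eqxx big_cons.
rewrite [LHS]big_seq [RHS]big_seq; apply: eq_bigr => l.
rewrite mem_rem_uniq // inE => /andP[lp _].
by rewrite /content /= eq_sym (negbTE lp).
Qed.

Lemma count_sum (T : Type) (P : pred T) (s : seq T) :
  (count P s)%:R = \sum_(y <- s) (P y)%:R :> R.
Proof.
by elim: s => [|y s IH]; rewrite ?big_nil ?big_cons //= natrD IH.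
Qed.

Lemma phi_ge0 t x : 0 < t -> 0 <= x -> 0 <= phi t x.
Proof. by move=> t0 x0; rewrite /phi le_min ler01 divr_ge0 // ltW. Qed.

Lemma phi_le1 t x : phi t x <= 1.
Proof. by rewrite /phi ge_min lexx. Qed.

Lemma phi_le_div t x : phi t x <= x / t.
Proof. by rewrite /phi ge_min lexx orbT. Qed.

Lemma le_phi t : 0 < t -> {homo phi t : x y / x <= y}.
Proof.
by move=> t0 x y xy; rewrite /phi le_min !ge_min lexx /= ler_pM2r ?invr_gt0 // xy orbT.
Qed.

Lemma phi_anti t1 t2 x : 0 < t1 -> t1 <= t2 -> 0 <= x -> phi t2 x <= phi t1 x.
Proof.
move=> t10 t12 x0; rewrite /phi le_min !ge_min lexx /=.
by rewrite ler_wpM2l ?orbT // lef_pV2 // posrE (lt_le_trans t10).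
Qed.

Lemma phi_sum t s : 0 < t -> all (fun x => 0 < x) s ->
  phi t (\sum_(y <- s) y) <= \sum_(y <- s) phi t y.
Proof.
move=> t0; elim: s => [|y s IH] /=.
  by move=> _; rewrite !big_nil (le_trans (phi_le_div _ _)) // mul0r.
move=> /andP[y0 s0]; rewrite !big_cons; apply: le_trans (_ : phi t y + phi t (\sum_(j <- s) j) <= _); last first.
  by rewrite lerD2l IH.
have S0 : 0 <= \sum_(j <- s) j.
  by rewrite big_seq sumr_ge0 // => j js; apply/ltW/(allP s0).
have := divr_ge0 S0 (ltW t0); have := divr_gt0 y0 t0; rewrite /phi mulrDl.
set a := y / t; set b := _ / t => a0 b0.
by rewrite /Num.min; do 3 case: ifP; lra.
Qed.

Lemma phi_ge_double t x : 0 < t <= 2^-1 -> 0 <= x -> x <= 2^-1 -> 2 * x <= phi t x.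
Proof.
move=> /andP[t0 t2] x0 x2; rewrite /phi le_min; apply/andP; split; first by lra.
by rewrite ler_pdivlMr // ; nra.
Qed.

Lemma weight_ge0 t y : 0 < t -> 0 < y -> 0 <= weight t y.
Proof.
move=> t0 y0; rewrite /weight; case: ifP => _; first by rewrite subr_ge0 phi_le1.
by rewrite phi_ge0 // ltW.
Qed.

Lemma sum_weight_ge0 t C : 0 < t -> valid_input C -> 0 <= \sum_(y <- C) weight t y.
Proof.
move=> t0 /allP vC; rewrite big_seq sumr_ge0 // => y /vC /andP[y0 _].
exact: weight_ge0.
Qed.

Lemma sum_small C : count large C = 0%N ->
  forall F G : R -> R, \sum_(y <- C) (if large y then F y else G y) = \sum_(y <- C) G y.
Proof.
move=> C0 F G; rewrite big_seq [RHS]big_seq; apply: eq_bigr => y yC.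
case: ifP => // ly; have : has large C by apply/hasP; exists y.
by rewrite has_count C0.
Qed.

(** A threshold of at most 1/2 makes every small item worth at least twice its size, so a volume of
    1 is worth 2. *)
Lemma bin_weight_small t C : 0 < t <= 2^-1 -> valid_input C -> 1 <= \sum_(y <- C) y ->
  count large C = 0%N -> 2 <= \sum_(y <- C) weight t y.
Proof.
move=> tb /allP vC C1 C0; rewrite /weight sum_small //.
apply: le_trans (_ : \sum_(y <- C) (2 * y) <= _); first by rewrite -mulr_sumr; lra.
rewrite big_seq [leRHS]big_seq; apply: ler_sum => y yC.
have /andP[y0 y1] := vC y yC; apply: phi_ge_double => //; first exact: ltW.
have : ~~ large y.
  by apply/negP => ly; have : has large C; [apply/hasP; exists y|rewrite has_count C0].
by rewrite /large -ltNge => /ltW.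
Qed.

Lemma bin_weight_special t C : 0 < t -> valid_input C -> 1 <= \sum_(y <- C) y ->
  count large C = 1%N -> 1 <= \sum_(y <- C) weight t y.
Proof.
move=> t0 vC C1 c1.
have /hasP[y yC ly] : has large C by rewrite has_count c1.
have pC := perm_to_rem yC.
have c0 : count large (rem y C) = 0%N.
  by move/permP: pC => /(_ large); rewrite c1 /= ly; case.
have vr : all (fun x => 0 < x) (rem y C).
  apply/allP => x /mem_rem xC.
  by have /andP[] := allP vC x xC.
rewrite (perm_big _ pC) big_cons /= {1}/weight ly.
have -> : \sum_(j <- rem y C) weight t j = \sum_(j <- rem y C) phi t j.
  by rewrite /weight sum_small.
have h1 := phi_sum t0 vr.
rewrite (perm_big _ pC) big_cons /= in C1.
have : phi t (1 - y) <= phi t (\sum_(j <- rem y C) j) by apply: le_phi; lra.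
lra.
Qed.

(** These fields are all that the proof retains of an optimal packing. In [profile_weight], covered
    bins with two or more large items are bounded by 0 only. *)
Record opt_profile (s : seq R) (n a b c : nat) : Prop := {
  profile_bins : (a + b + c = n)%N ;
  profile_large : (2 * a + b <= count large s)%N ;
  profile_small : c%:R <= \sum_(y <- s) (if large y then 0 else y) ;
  profile_weight : forall t, 0 < t <= 2^-1 ->
    (b + 2 * c)%:R <= \sum_(y <- s) weight t y }.

Lemma ler_sum_count (T : eqType) (D : seq T) (P : pred T) (F : T -> R) :
  (forall l, l \in D -> (P l)%:R <= F l) -> (count P D)%:R <= \sum_(l <- D) F l.
Proof.
by move=> h; rewrite count_sum big_seq [leRHS]big_seq; apply: ler_sum.
Qed.

Lemma opt_profile_exists (s : seq R) : valid_input s ->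
  exists a b c, opt_profile s (opt s) a b c.
Proof.
move=> vs; have [f <-] : exists f : (size s).-tuple 'I_(size s),
    num_covered s [seq val j | j <- f] = opt s.
  have [->|s0] := eqVneq s [::].
    exists [tuple]; rewrite /opt; apply/esym/eqP; rewrite eqn_leq; apply/andP; split.
      by apply/bigmax_leqP => i _; rewrite (tuple0 i).
    by rewrite /num_covered.
  have h : (0 < #|{: (size s).-tuple 'I_(size s)}|)%N.
    by rewrite card_tuple card_ord expn_gt0 lt0n size_eq0 s0.
  have [f hf] := @bigop.eq_bigmax ((size s).-tuple 'I_(size s))
    (fun f => num_covered s [seq val j | j <- tval f]) h.
  by exists f; rewrite /opt hf.
set F := [seq val j | j <- f].
have sF : size F = size s by rewrite size_map size_tuple.
set Z := zip s F; set D := undup F.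
(* Regrouping the items by bins reduces each field to an estimate for a single bin. *)
have sZ (G : R -> R) : \sum_(y <- s) G y = \sum_(l <- D) \sum_(y <- content Z l) G y.
  rewrite -(sum_content (Z := Z)) ?undup_uniq //; last first.
    move=> p pZ; rewrite mem_undup -(unzip2_zip (s := s) (t := F)) ?sF //.
    exact: map_f.
  by rewrite -(big_map fst xpredT) -/(unzip1 Z) unzip1_zip // sF.
have vZ l : valid_input (content Z l).
  apply/allP => y /mapP[p]; rewrite mem_filter => /andP[_ pZ] ->.
  apply: (allP vs); rewrite -(unzip1_zip (s := s) (t := F)) ?sF //.
  exact: map_f.
pose cov l := 1 <= \sum_(y <- content Z l) y.
have lE l : load s F l = \sum_(y <- content Z l) y by rewrite big_content.
pose nl l := count large (content Z l).
exists (count (fun l => cov l && (1 < nl l)%N) D),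
  (count (fun l => cov l && (nl l == 1)%N) D), (count (fun l => cov l && (nl l == 0)%N) D).
have ge0 (G : R -> R) l : (forall y, 0 < y -> 0 <= G y) -> 0 <= \sum_(y <- content Z l) G y.
  move=> h; rewrite big_seq sumr_ge0 // => y /(allP (vZ l)) /andP[y0 _]; exact: h.
split.
- have -> : num_covered s F = count cov D by apply: eq_count => l; rewrite lE.
  elim: (D) => //= l D' <-; case: (cov l) => //=; case: (nl l) => [|[|k]] /=; lia.
- rewrite -(ler_nat R) [leRHS]count_sum sZ natrD natrM !count_sum mulr_sumr -big_split /=.
  apply: ler_sum => l _; rewrite -count_sum -/(nl l).
  rewrite -natrM -natrD ler_nat.
  by case: (cov l) => //=; case: (nl l) => [|[|k]].
- rewrite sZ; apply: ler_sum_count => l _.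
  have : 0 <= \sum_(y <- content Z l) (if large y then 0 else y).
    by apply: ge0 => y y0; case: ifP => // _; apply: ltW.
  case: (boolP (cov l)) => //= cl; case: eqP => //= n0 _.
  by rewrite (sum_small n0 (fun=> 0) id).
- move=> t tb; have t0 : 0 < t by case/andP: tb.
  rewrite sZ natrD natrM !count_sum mulr_sumr -big_split /=.
  apply: ler_sum => l _.
  have := sum_weight_ge0 t0 (vZ l).
  case: (boolP (cov l)) => //= [cl|_]; last by rewrite mulr0 addr0.
  case: (boolP (nl l == 1)%N) => [/eqP n1|_] /=.
    by rewrite n1 mulr0 addr0 => _; apply: bin_weight_special.
  case: (boolP (nl l == 0)%N) => [/eqP n1|_] /=; last by rewrite mulr0 addr0.
  by rewrite mulr1 add0r => _; apply: bin_weight_small.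
Qed.

End Packings.

(** * The algorithm *)

Section Algorithm.
Context (R : realType).

(* The first component is the kind of the bin: 0 for the stock, 1 for the bins
   opened by the first [q] large items, 2 for pairs of large items and 3 for
   small items only. *)
Definition label : Type := (nat * nat)%type.
(* The newest item comes first. *)
Definition history : Type := seq (R * label).

Implicit Types (H : history) (l : label) (ls : seq label) (x y t : R) (k n : nat).

Definition wsum (w : R -> R) H l : R := \sum_(y <- content H l) w y.

Definition ld H l : R := wsum id H l.

Definition nlarge H : nat := count (@large R) (unzip1 H).

Definition is_open H l : bool := ld H l < 1.

Definition first_open H ls : label :=
  nth (0%N, 0%N) ls (find (is_open H) ls).

(** One label more than there are items always leaves an open bin, since every covered bin holds at
    least one item. *)
Definition chain H k : seq label := [seq (k, i) | i <- iota 0 (size H).+1].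

Definition stock (r : nat) : seq label := [seq (0%N, j) | j <- iota 0 r].

Definition least_loaded H ls : label :=
  head (0%N, 0%N) (sort (fun l1 l2 => ld H l1 <= ld H l2) ls).

(** Histories run backwards; reversing restores the order of arrival, so that entry [j] is the item
    that opened bin [(1, j)]. *)
Definition firsts (q : nat) H : seq R := take q (rev [seq y <- unzip1 H | large y]).

Definition ranking (F : seq R) : seq nat :=
  sort (fun i j => nth 0 F j <= nth 0 F i) (iota 0 (size F)).

(** Kept bins have the smallest gaps and wait for small items. The spare ones are completed by a
    second large item. *)
Definition kept (g : nat) (F : seq R) : seq label :=
  [seq (1%N, j) | j <- take g (ranking F)].

Definition spare (g : nat) (F : seq R) : seq label :=
  [seq (1%N, j) | j <- drop g (ranking F)].

Definition fits H x l : bool := ~~ has (@large R) (content H l) && (1 <= ld H l + x).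

Definition place (q r g : nat) H x : label :=
  if (nlarge H < q)%N then
    if large x then (1%N, nlarge H)
    else if r == 0%N then first_open H (chain H 3) else least_loaded H (stock r)
  else
    let F := firsts q H in
    if large x then
      if has (fits H x) (stock r) then nth (0%N, 0%N) (stock r) (find (fits H x) (stock r))
      else first_open H (spare g F ++ chain H 2)
    else first_open H (kept g F ++ chain H 3).

Definition run (q r g : nat) (s : seq R) : history :=
  foldl (fun H x => (x, place q r g H x) :: H) [::] s.

Definition valid_history H : bool := valid_input (unzip1 H).

Lemma content_cons H x l l' :
  content ((x, l) :: H) l' = if l == l' then x :: content H l' else content H l'.
Proof. by rewrite /content /=; case: eqP. Qed.

Lemma wsum_cons w H x l l' :
  wsum w ((x, l) :: H) l' = (if l == l' then w x else 0) + wsum w H l'.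
Proof. by rewrite /wsum content_cons; case: eqP; rewrite ?big_cons ?add0r. Qed.

Lemma ld_cons H x l l' : ld ((x, l) :: H) l' = (if l == l' then x else 0) + ld H l'.
Proof. exact: wsum_cons. Qed.

Lemma wsum_in H ls w : uniq ls ->
  \sum_(p <- H | p.2 \in ls) w p.1 = \sum_(l <- ls) wsum w H l.
Proof.
move=> u; rewrite -big_filter (sum_content (L := ls)) //; last first.
  by move=> p; rewrite mem_filter => /andP[].
rewrite big_seq [RHS]big_seq; apply: eq_bigr => l lls; congr (\sum_(i <- map _ _) _).
by rewrite -filter_predI; apply: eq_filter => p /=; case: eqP => //= ->; rewrite lls.
Qed.

Lemma mem_content_history H l y : y \in content H l -> y \in unzip1 H.
Proof. by case/mapP => p; rewrite mem_filter => /andP[_ pH] ->; apply: map_f. Qed.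

Lemma content_neq0 H l : content H l != [::] -> l \in unzip2 H.
Proof.
rewrite /content; case E : [seq p <- H | p.2 == l] => [//|p s] _.
have : p \in p :: s by rewrite inE eqxx.
by rewrite -E mem_filter => /andP[/eqP <- pH]; apply: map_f.
Qed.

Lemma wsum_ge0 w H l : valid_history H -> (forall y, 0 < y -> 0 <= w y) -> 0 <= wsum w H l.
Proof.
move=> vH w0; rewrite /wsum big_seq sumr_ge0 // => y /mem_content_history yH.
by case/andP: (allP vH y yH) => y0 _; apply: w0.
Qed.

Lemma ld_ge0 H l : valid_history H -> 0 <= ld H l.
Proof. by move=> vH; apply: wsum_ge0 => // y /ltW. Qed.

Lemma ld_mono H x l l' : 0 < x -> ld H l' <= ld ((x, l) :: H) l'.
Proof. by move=> x0; rewrite ld_cons lerDr; case: eqP => // _; apply: ltW. Qed.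

Lemma covered_in_history H l : 1 <= ld H l -> l \in unzip2 H.
Proof.
move=> c; apply: content_neq0; apply/eqP => c0.
by move: c; rewrite /ld /wsum c0 big_nil ler10.
Qed.

(* Bins [(k, 0), (k, 1), ...] filled one after the other, [(k, n)] being the
   current one. *)
Record chain_at k (w : R -> R) (om : R) H n : Prop := {
  chain_full : forall i, (i < n)%N -> 1 <= ld H (k, i) ;
  chain_open : ld H (k, n) < 1 ;
  chain_new : forall i, (n < i)%N -> content H (k, i) = [::] ;
  chain_sum : \sum_(p <- H | p.2.1 == k) w p.1 <= om * n%:R + wsum w H (k, n) }.

Lemma chain_at_nil k w om : chain_at k w om [::] 0.
Proof.
split=> //.
- by rewrite /ld /wsum big_nil ltr01.
- by rewrite big_nil /wsum big_nil mulr0 addr0.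
Qed.

Lemma chain_at_other k w om H n x l : l.1 != k -> chain_at k w om H n ->
  chain_at k w om ((x, l) :: H) n.
Proof.
move=> lk [c1 c2 c3 c4].
have ne i : (l == (k, i)) = false by apply: contraNF lk => /eqP ->.
split=> [i|||].
- by rewrite ld_cons ne add0r; apply: c1.
- by rewrite ld_cons ne add0r.
- by move=> i ni; rewrite content_cons ne c3.
- by rewrite big_cons /= (negbTE lk) wsum_cons ne add0r.
Qed.

(** An item that covers the current bin moves the chain on to [n.+1]. The bin left behind was open
    until then, so the hypothesis bounds its final weight by [om]. *)
Lemma chain_at_self k w om H n x :
  (ld H (k, n) < 1 -> wsum w H (k, n) + w x <= om) ->
  0 < x -> chain_at k w om H n ->
  exists n', chain_at k w om ((x, (k, n)) :: H) n'.
Proof.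
move=> hw x0 [c1 c2 c3 c4].
have nn i : ((k, n) == (k, i)) = (n == i).
  by rewrite xpair_eqE eqxx.
have [lt1|ge1] := ltP (x + ld H (k, n)) 1.
  exists n; split=> [i ni|||].
  - by rewrite (le_trans (c1 i ni)) // ld_mono.
  - by rewrite ld_cons eqxx.
  - by move=> i ni; rewrite content_cons nn ltn_eqF // c3.
  - by rewrite big_cons /= eqxx wsum_cons eqxx addrCA lerD2l.
exists n.+1; split=> [i|||].
- rewrite ltnS leq_eqVlt => /orP[/eqP->|ni]; first by rewrite ld_cons eqxx.
  by rewrite (le_trans (c1 i ni)) // ld_mono.
- by rewrite ld_cons nn ltn_eqF // add0r /ld /wsum c3 // big_nil ltr01.
- by move=> i ni; rewrite content_cons nn ltn_eqF ?c3 //; apply: ltnW.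
- rewrite big_cons /= eqxx wsum_cons nn ltn_eqF // add0r.
  have -> : wsum w H (k, n.+1) = 0 by rewrite /wsum c3 // big_nil.
  rewrite addr0.
  have := hw c2; rewrite -natr1; lra.
Qed.

Lemma chain_at_size k w om H n : chain_at k w om H n -> (n <= size H)%N.
Proof.
case=> c1 _ _ _; rewrite -(size_iota 0 n) -(size_map (pair k)) -(size_map snd H).
apply: uniq_leq_size.
  by rewrite map_inj_uniq ?iota_uniq // => i j [].
by move=> l /mapP[i]; rewrite mem_iota /= => ni ->; apply/covered_in_history/c1.
Qed.

Lemma first_open_has H ls ls' : has (is_open H) ls ->
  first_open H (ls ++ ls') \in ls /\ ld H (first_open H (ls ++ ls')) < 1.
Proof.
move=> h; have hs : (find (is_open H) ls < size ls)%N by rewrite -has_find.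
rewrite /first_open find_cat h nth_cat hs; split; first exact: mem_nth.
exact: (nth_find (0%N, 0%N) h).
Qed.

Lemma first_open_chain H ls k w om n : chain_at k w om H n ->
  ~~ has (is_open H) ls -> first_open H (ls ++ chain H k) = (k, n).
Proof.
move=> ch h; have nH := chain_at_size ch; case: ch => c1 c2 _ _.
suff e : find (is_open H) (chain H k) = n.
  rewrite /first_open find_cat (negbTE h) e nth_cat -{2}[size ls]addn0 ltn_add2l ltn0 addKn.
  by rewrite (nth_map 0%N) ?size_iota ?ltnS // nth_iota.
rewrite /chain -{1}(subnKC nH) -addnS iotaD map_cat find_cat /=.
have -> : has (is_open H) [seq (k, i) | i <- iota 0 n] = false.
  apply/negbTE; rewrite has_map; apply/hasPn => i; rewrite mem_iota /= => ni.
  by rewrite /= /is_open -leNgt c1.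
by rewrite size_map size_iota add0n /is_open c2 addn0.
Qed.

Lemma least_loaded_mem H ls : ls != [::] -> least_loaded H ls \in ls.
Proof.
rewrite /least_loaded => ls0; rewrite -(mem_sort (fun l1 l2 => ld H l1 <= ld H l2)).
case E : (sort _ ls) => [|a s]; last by rewrite inE eqxx.
by move: ls0; rewrite -size_eq0 -(size_sort (fun l1 l2 => ld H l1 <= ld H l2)) E.
Qed.

Lemma least_loaded_min H ls l : l \in ls -> ld H (least_loaded H ls) <= ld H l.
Proof.
set e := fun l1 l2 => ld H l1 <= ld H l2.
have tot : total e by move=> a b; apply: le_total.
have tr : transitive e by move=> a b c; apply: le_trans.
rewrite /least_loaded -/e -(mem_sort e); have := sort_sorted tot ls.
case: (sort e ls) => //= a s; rewrite (path_sortedE tr) => /andP[/allP h _].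
by rewrite inE => /orP[/eqP->//|/h].
Qed.

Lemma ranking_perm (F : seq R) : perm_eq (ranking F) (iota 0 (size F)).
Proof. by rewrite /ranking perm_sort. Qed.

Lemma ranking_uniq (F : seq R) : uniq (ranking F).
Proof. by rewrite (perm_uniq (ranking_perm F)) iota_uniq. Qed.

Lemma ranking_le g (F : seq R) i j : i \in take g (ranking F) -> j \in drop g (ranking F) ->
  nth 0 F j <= nth 0 F i.
Proof.
set e := fun i j => nth 0 F j <= nth 0 F i.
have tot : total e by move=> a b; rewrite /e; apply: le_total.
have tr : transitive e by move=> a b c; rewrite /e => ba ac; apply: le_trans ac ba.
have : sorted e (ranking F) by apply: sort_sorted.
rewrite (sorted_pairwise tr) -{1}(cat_take_drop g (ranking F)) pairwise_cat.
by case/and3P => /allrelP h _ _ iK jW; apply: h.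
Qed.

Lemma count_lt (T : eqType) (P P' : pred T) (s : seq T) (z : T) :
  (forall a, P a -> P' a) -> z \in s -> ~~ P z -> P' z -> (count P s < count P' s)%N.
Proof.
move=> PP zs Pz P'z; elim: s zs => //= a s IH; rewrite inE.
have le : (count P s <= count P' s)%N by apply: sub_count.
case/orP => [/eqP <-|/IH lt]; first by rewrite (negbTE Pz) P'z; lia.
have := PP a; case: (P a) => /= [->//|_]; lia.
Qed.

End Algorithm.

(** * Invariants *)

Section Phases.
Context (R : realType).
Implicit Types (H : history R) (l : label) (x y t : R) (q r g n : nat).

Definition small_phi t y : R := if large y then 0 else phi t y.

Definition small_size y : R := if large y then 0 else y.

Definition matched r H : nat := count (fun l => has (@large R) (content H l)) (stock r).

(** [p1_even] expresses the even spreading of the stock: as long as one stock bin has load at most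
    [t], no stock bin has truncated weight above 2. *)
Record phase1 r H : Prop := {
  p1_valid : valid_history H ;
  p1_large : forall p, p \in H -> large p.1 -> p.2.1 = 1%N ;
  p1_small : forall p, p \in H -> ~~ large p.1 ->
    p.2 \in stock r \/ r = 0%N /\ p.2.1 = 3%N ;
  p1_own : forall j, content H (1%N, j) =
    if (j < nlarge H)%N then [:: nth 0 (rev [seq y <- unzip1 H | large y]) j] else [::] ;
  p1_chain : exists n, chain_at 3 id (3 / 2) H n ;
  p1_even : forall t, 0 < t -> forall l, l \in stock r -> ld H l <= t ->
    forall l', l' \in stock r -> wsum (phi t) H l' <= 2 }.

Record phase2 q r g H1 H2 : Prop := {
  p2_valid : valid_history (H2 ++ H1) ;
  p2_open : forall l, l \in stock r -> ~~ has (@large R) (content (H2 ++ H1) l) ->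
    ld (H2 ++ H1) l = ld H1 l /\
    (count (fun y => large y && (1 <= ld H1 l + y)%R) (unzip1 H2) <= matched r (H2 ++ H1))%N ;
  p2_full : forall l, l \in stock r -> has (@large R) (content (H2 ++ H1) l) ->
    1 <= ld (H2 ++ H1) l ;
  p2_kept : forall l, l \in kept g (firsts q H1) ->
    ld (H2 ++ H1) l = nth 0 (firsts q H1) l.2 + wsum small_size (H2 ++ H1) l /\
    forall t, 0 < t ->
      wsum (small_phi t) (H2 ++ H1) l <= (1 - nth 0 (firsts q H1) l.2) / t + 1 ;
  p2_kept_open : has (is_open (H2 ++ H1)) (kept g (firsts q H1)) ->
    forall p, p \in H2 -> ~~ large p.1 -> p.2 \in kept g (firsts q H1) ;
  p2_own : forall j, (j < q)%N -> 2^-1 <= ld (H2 ++ H1) (1%N, j) ;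
  p2_spare_open : has (is_open (H2 ++ H1)) (spare g (firsts q H1)) ->
    forall p, p \in H2 ++ H1 -> p.2.1 != 2%N ;
  p2_chain2 : exists n, chain_at 2 (fun y => (large y)%:R) 2 (H2 ++ H1) n ;
  p2_chain3 : exists n, chain_at 3 id (3 / 2) (H2 ++ H1) n ;
  p2_count : (nlarge (H2 ++ H1))%:R <=
    (q + matched r (H2 ++ H1) +
     count (fun l => ~~ is_open (H2 ++ H1) l) (spare g (firsts q H1)))%:R +
    \sum_(p <- H2 ++ H1 | p.2.1 == 2%N) (large p.1)%:R :> R ;
  p2_small : r = 0%N -> g = 0%N -> forall p, p \in H2 ++ H1 -> ~~ large p.1 -> p.2.1 = 3%N }.

Lemma stock_kind r l : l \in stock r -> l.1 = 0%N.
Proof. by case/mapP => j _ ->. Qed.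

Lemma ranking_lt (F : seq R) j : j \in ranking F -> (j < size F)%N.
Proof. by rewrite (perm_mem (ranking_perm F)) mem_iota. Qed.

Lemma kept_kind g (F : seq R) l : l \in kept g F -> l.1 = 1%N /\ (l.2 < size F)%N.
Proof. by case/mapP => j /mem_take /ranking_lt jF ->. Qed.

Lemma spare_kind g (F : seq R) l : l \in spare g F -> l.1 = 1%N /\ (l.2 < size F)%N.
Proof. by case/mapP => j /mem_drop /ranking_lt jF ->. Qed.

Lemma kept_uniq g (F : seq R) : uniq (kept g F).
Proof.
rewrite map_inj_in_uniq ?take_uniq ?ranking_uniq // => i j _ _; by case.
Qed.

Lemma spare_uniq g (F : seq R) : uniq (spare g F).
Proof.
rewrite map_inj_in_uniq ?drop_uniq ?ranking_uniq // => i j _ _; by case.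
Qed.

Lemma stock_uniq r : uniq (stock r).
Proof. by rewrite map_inj_in_uniq ?iota_uniq // => i j _ _; case. Qed.

Lemma kept_spare g (F : seq R) l : l \in kept g F -> l \notin spare g F.
Proof.
case/mapP => i iK ->; apply/negP => /mapP[j jW [ij]]; subst j.
have := ranking_uniq F; rewrite -{1}(cat_take_drop g (ranking F)) cat_uniq.
by case/and3P => _ /hasPn /(_ i jW); rewrite /= iK.
Qed.

Lemma nlarge_cons H x l : nlarge ((x, l) :: H) = (large x + nlarge H)%N.
Proof. by []. Qed.

Lemma nlarge_cat H H' : nlarge (H ++ H') = (nlarge H + nlarge H')%N.
Proof. by rewrite /nlarge /unzip1 map_cat count_cat. Qed.

Lemma size_firsts q H : nlarge H = q -> size (firsts q H) = q.
Proof.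
by move=> e; rewrite /firsts size_takel // size_rev size_filter -/(nlarge H) e.
Qed.

Lemma firsts_all q H : nlarge H = q -> firsts q H = rev [seq y <- unzip1 H | large y].
Proof. by move=> e; rewrite /firsts take_oversize // size_rev size_filter -/(nlarge H) e. Qed.

(** The ranking is frozen once [q] large items have arrived, so kept and spare bins never exchange
    roles. *)
Lemma firsts_cat q H1 H2 : nlarge H1 = q -> firsts q (H2 ++ H1) = firsts q H1.
Proof.
move=> e; rewrite (firsts_all e) /firsts /unzip1 map_cat filter_cat rev_cat.
by rewrite take_size_cat // size_rev size_filter -/(nlarge H1).
Qed.

Lemma firsts_large q H y : y \in firsts q H -> large y.
Proof. by move/mem_take; rewrite mem_rev mem_filter => /andP[]. Qed.

Lemma matched_mono r H x l : (matched r H <= matched r ((x, l) :: H))%N.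
Proof.
apply: sub_count => l'; rewrite content_cons; case: eqP => // _ /= ->.
by rewrite orbT.
Qed.

Lemma matched_lt r H x l : l \in stock r -> ~~ has (@large R) (content H l) -> large x ->
  (matched r H < matched r ((x, l) :: H))%N.
Proof.
move=> ls lh lx; apply: (count_lt _ ls) => //.
  by move=> l'; rewrite content_cons; case: eqP => // _ /= ->; rewrite orbT.
by rewrite content_cons eqxx /= lx.
Qed.

Lemma small_phi_wsum t H l : 0 < t -> valid_history H ->
  wsum (small_phi t) H l <= wsum (phi t) H l.
Proof.
move=> t0 vH; rewrite /wsum big_seq [leRHS]big_seq; apply: ler_sum => y /mem_content_history yH.
rewrite /small_phi; case: ifP => // _; apply: phi_ge0 => //.
by case/andP: (allP vH y yH) => /ltW.
Qed.

Lemma wsum_phi_le t H l : wsum (phi t) H l <= ld H l / t.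
Proof. by rewrite /ld /wsum mulr_suml; apply: ler_sum => y _; apply: phi_le_div. Qed.

Lemma phase1_nil r : phase1 r [::].
Proof.
split=> //; first by exists 0%N; apply: chain_at_nil.
by move=> t t0 l _ _ l' _; rewrite /wsum big_nil; lra.
Qed.

Lemma chain3_step H x n : 0 < x -> ~~ large x -> chain_at 3 id (3 / 2) H n ->
  exists n', chain_at 3 id (3 / 2) ((x, (3%N, n)) :: H) n'.
Proof.
rewrite /large -ltNge => x0 xs; apply: chain_at_self => //.
rewrite /ld => h; lra.
Qed.

Lemma phase1_step q r g H x : phase1 r H -> (nlarge H < q)%N -> 0 < x <= 1 ->
  phase1 r ((x, place q r g H x) :: H).
Proof.
move=> [pv pl ps po [n pc] pe] nq xb; have x0 : 0 < x by case/andP: xb.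
have vH' l : valid_history ((x, l) :: H) by rewrite /valid_history /= xb.
rewrite /place nq; have [lx|sx] := boolP (large x).
  have ne l : l.1 != 1%N -> ((1%N, nlarge H) == l) = false.
    by move=> h; apply: contraNF h => /eqP <-.
  split=> //.
  - by move=> p; rewrite inE => /orP[/eqP-> //|]; apply: pl.
  - by move=> p; rewrite inE => /orP[/eqP-> /=|]; [rewrite lx|apply: ps].
  - move=> j; rewrite content_cons nlarge_cons lx add1n ltnS /= lx rev_cons nth_rcons.
    rewrite size_rev size_filter -/(nlarge H) po xpair_eqE eqxx /=.
    by rewrite (eq_sym (nlarge H)); case: ltngtP.
  - by exists n; apply: chain_at_other.
  - move=> t t0 l ls; rewrite ld_cons ne ?(stock_kind ls) // add0r => lt l' ls'.
    by rewrite wsum_cons ne ?(stock_kind ls') // add0r; apply: (pe _ t0 l).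
case: (eqVneq r 0%N) => [r0|r0].
  rewrite (first_open_chain (ls := [::]) pc) //.
  split=> //.
  - move=> p; rewrite inE => /orP[/eqP-> /=|]; last exact: pl.
    by rewrite (negbTE sx).
  - move=> p; rewrite inE => /orP[/eqP-> _|]; last exact: ps.
    by right.
  - by move=> j; rewrite content_cons nlarge_cons (negbTE sx) /= (negbTE sx).
  - exact: chain3_step.
  - by rewrite r0.
have sr : stock r != [::] by rewrite -size_eq0 size_map size_iota.
set l0 := least_loaded H (stock r); have l0s : l0 \in stock r by apply: least_loaded_mem.
have k0 := stock_kind l0s.
split=> //.
- move=> p; rewrite inE => /orP[/eqP-> /=|]; last exact: pl.
  by rewrite (negbTE sx).
- by move=> p; rewrite inE => /orP[/eqP-> _|]; [left|apply: ps].
- move=> j; rewrite content_cons nlarge_cons (negbTE sx) /= (negbTE sx) po.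
  by case: eqP => // e; move: k0; rewrite e.
- by exists n; apply: chain_at_other => //; rewrite k0.
- move=> t t0 l ls lt l' ls'.
  have lt' : ld H l <= t by apply: le_trans lt; apply: ld_mono.
  rewrite wsum_cons; case: eqP => [<-|_]; last by rewrite add0r; apply: (pe _ t0 l).
  (* The receiving bin is the lightest, hence of load at most [t] and weight at most 1 beforehand;
     the new item adds at most 1. *)
  have h1 : ld H l0 <= t by apply: le_trans lt'; apply: least_loaded_min.
  have h2 : ld H l0 / t <= 1 by rewrite ler_pdivrMr // mul1r.
  have := wsum_phi_le t H l0; have := phi_le1 t x; lra.
Qed.

Lemma phase2_start q r g H1 : phase1 r H1 -> nlarge H1 = q -> phase2 q r g H1 [::].
Proof.
move=> [pv pl ps po [n pc] pe] nq; have sF := size_firsts nq.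
have own j : (j < q)%N -> content H1 (1%N, j) = [:: nth 0 (firsts q H1) j].
  by move=> jq; rewrite po nq jq (firsts_all nq).
have k2 p : p \in H1 -> p.2.1 != 2%N.
  move=> pH; have [/(pl _ pH) -> //|/(ps _ pH) [/stock_kind -> //|[_ ->] //]] := boolP (large p.1).
have nolarge l : l \in stock r -> ~~ has (@large R) (content H1 l).
  move=> ls; apply/hasPn => y /mapP[p]; rewrite mem_filter => /andP[/eqP pl' pH] ->.
  by apply/negP => /(pl _ pH); rewrite pl' (stock_kind ls).
have Fl j : (j < q)%N -> large (nth 0 (firsts q H1) j).
  by move=> jq; apply: (@firsts_large q H1); rewrite mem_nth ?sF.
split=> //=.
- by move=> l ls lh; move: (nolarge l ls); rewrite lh.
- move=> l lK; have [] := kept_kind lK; rewrite sF; case: l lK => k j lK /= -> jq.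
  rewrite /ld /wsum own // !big_seq1 /small_size /small_phi Fl // addr0; split=> // t t0.
  rewrite big_seq1 Fl //; apply: addr_ge0 => //; rewrite divr_ge0 ?(ltW t0) // subr_ge0.
  have : nth 0 (firsts q H1) j \in content H1 (1%N, j) by rewrite own // inE.
  by move/mem_content_history => /(allP pv) /andP[].
- by move=> j jq; rewrite /ld /wsum own // big_seq1; apply: Fl.
- exists 0%N; split=> // [|i _|].
  + rewrite /ld /wsum /content; case E: [seq p <- H1 | p.2 == (2%N, 0%N)] => [|p s].
      by rewrite big_nil ltr01.
    have : p \in p :: s by rewrite inE eqxx.
    by rewrite -E mem_filter => /andP[/eqP e /k2]; rewrite e.
  + rewrite /content; case E: [seq p <- H1 | p.2 == (2%N, i)] => [//|p s].
    have : p \in p :: s by rewrite inE eqxx.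
    by rewrite -E mem_filter => /andP[/eqP e /k2]; rewrite e.
  + rewrite mulr0 add0r big_seq_cond big1; last by move=> p /andP[/k2 /negbTE ->].
    exact: wsum_ge0.
- by exists n.
- rewrite nq -addnA natrD -addrA lerDl addr_ge0 //; exact: sumr_ge0.
- by move=> r0 g0 p pH /(ps _ pH) [|[]//]; rewrite r0.
Qed.

End Phases.

(** * Preservation of the invariant of the second phase *)

Section SecondPhase.
Context (R : realType).
Implicit Types (H : history R) (l : label) (x y t : R) (q r g n : nat).

(** Each case records the searches that failed before it: these failures carry the invariants about
    open kept and spare bins. *)
Variant place_spec r g H (F : seq R) x : label -> Prop :=
| PlaceFit l of large x & l \in stock r & fits H x l : place_spec r g H F x l
| PlaceSpare l of large x & ~~ has (fits H x) (stock r) & l \in spare g F & is_open H l :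
    place_spec r g H F x l
| PlacePair n of large x & ~~ has (fits H x) (stock r) & ~~ has (is_open H) (spare g F)
    & chain_at 2 (fun y => (large y)%:R) 2 H n : place_spec r g H F x (2%N, n)
| PlaceKept l of ~~ large x & l \in kept g F & is_open H l : place_spec r g H F x l
| PlaceSmall n of ~~ large x & ~~ has (is_open H) (kept g F) & chain_at 3 id (3 / 2) H n :
    place_spec r g H F x (3%N, n).

Lemma placeP q r g H1 H2 x : phase2 q r g H1 H2 -> nlarge H1 = q ->
  place_spec r g (H2 ++ H1) (firsts q H1) x (place q r g (H2 ++ H1) x).
Proof.
move=> ph nq; rewrite /place nlarge_cat nq ltnNge leq_addl /= firsts_cat //.
have [lx|sx] := boolP (large x).
  have [hf|nf] := boolP (has _ _).
    by apply: PlaceFit => //; [rewrite mem_nth // -has_find|apply: nth_find].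
  have [ho|no] := boolP (has (is_open (H2 ++ H1)) (spare g (firsts q H1))).
    by have [] := first_open_has (chain (H2 ++ H1) 2) ho; apply: PlaceSpare.
  have [n c] := p2_chain2 ph.
  by rewrite (first_open_chain c) //; apply: PlacePair.
have [ho|no] := boolP (has (is_open (H2 ++ H1)) (kept g (firsts q H1))).
  by have [] := first_open_has (chain (H2 ++ H1) 3) ho; apply: PlaceKept.
have [n c] := p2_chain3 ph.
by rewrite (first_open_chain c) //; apply: PlaceSmall.
Qed.

Lemma place_kind0 r g H (F : seq R) x l : place_spec r g H F x l ->
  l.1 = 0%N -> [/\ large x, l \in stock r & fits H x l].
Proof.
by case=> {}l // => [_ _ /spare_kind[->]|_ /kept_kind[->]].
Qed.

Lemma place_kept r g H (F : seq R) x l : place_spec r g H F x l ->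
  l \in kept g F -> ~~ large x /\ is_open H l.
Proof.
case=> [l0 _ /stock_kind k _|l0 _ _ lW _|n _ _ _ _|l0 sx _ o|n _ _ _] lK //.
- by have [] := kept_kind lK; rewrite k.
- by have := kept_spare lK; rewrite lW.
- by have [] := kept_kind lK.
- by have [] := kept_kind lK.
Qed.

Lemma is_open_cons H x l l' : 0 < x -> is_open ((x, l) :: H) l' -> is_open H l'.
Proof. by move=> x0; apply: le_lt_trans; apply: ld_mono. Qed.

Lemma has_open_cons H x l (ls : seq label) : 0 < x ->
  has (is_open ((x, l) :: H)) ls -> has (is_open H) ls.
Proof. by move=> x0; apply: sub_has => l'; apply: is_open_cons. Qed.

(** Two large items already have total size 1, so an open bin holds at most one of them. *)
Lemma pair_bound H l x : valid_history H -> ld H l < 1 ->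
  wsum (fun y => (large y)%:R) H l + (large x)%:R <= 2 :> R.
Proof.
move=> vH lo; have h : 2^-1 * wsum (fun y => (large y)%:R) H l <= ld H l.
  rewrite /ld /wsum mulr_sumr big_seq [leRHS]big_seq; apply: ler_sum => y /mem_content_history yH.
  have /andP[y0 _] := allP vH y yH.
  by rewrite /large; case: (lerP 2^-1 y) => /= hy; lra.
rewrite /wsum -count_sum in h *.
have : (count (@large R) (content H l) < 2)%N by rewrite -(ltr_nat R); lra.
rewrite -natrD ler_nat; case: (large x) => /=; lia.
Qed.

Lemma chain2_step H x n : valid_history H -> 0 < x ->
  chain_at 2 (fun y => (large y)%:R) 2 H n ->
  exists n', chain_at 2 (fun y => (large y)%:R) 2 ((x, (2%N, n)) :: H) n'.
Proof. by move=> vH x0; apply: chain_at_self => // h; apply: pair_bound. Qed.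

Lemma phase2_step q r g H1 H2 x : phase2 q r g H1 H2 -> nlarge H1 = q -> 0 < x <= 1 ->
  phase2 q r g H1 ((x, place q r g (H2 ++ H1) x) :: H2).
Proof.
move=> ph nq xb; have x0 : 0 < x by case/andP: xb.
have := placeP x ph nq; move: (place q r g (H2 ++ H1) x) => l sp.
have sF := size_firsts nq.
case: (ph) => pv po pf pk pko pw pso [n2 pc2] [n3 pc3] pn ps.
set H := H2 ++ H1 in po pf pk pko pw pso pc2 pc3 pn ps sp *.
set F := firsts q H1 in po pf pk pko pw pso pn sp sF *.
(* In this phase the stock receives large items only, so a stock bin still lacking one cannot be the
   bin just used. *)
have lne l' : l' \in stock r -> ~~ has (@large R) (content ((x, l) :: H) l') -> (l == l') = false.
  move=> ls; rewrite content_cons; case: eqP => // e; move: ls; rewrite -e => ls.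
  have [lx _ _] := place_kind0 sp (stock_kind ls).
  by rewrite /= lx.
split; rewrite ?cat_cons -/H -/F.
- by rewrite /valid_history /= xb.
- move=> l' ls lh; have ne := lne l' ls lh; move: lh; rewrite content_cons ne => lh.
  have [e c] := po l' ls lh; rewrite ld_cons ne add0r; split=> //=.
  case: (boolP (large x && _)) => [/andP[lx fx]|_]; last exact: leq_trans c (matched_mono _ _ _ _).
  (* As [x] fits the unmatched bin [l'], it was put into some unmatched stock bin, and [matched]
     grows together with the count. *)
  have fl' : fits H x l' by rewrite /fits lh e.
  have hf : has (fits H x) (stock r) by apply/hasP; exists l'.
  case: sp lne => // [l0 _ l0s /andP[l0h _]|l0 _|n _|l0|n]; rewrite ?hf ?lx // => _.
  rewrite add1n; apply: leq_ltn_trans c _; exact: matched_lt.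
- move=> l' ls; rewrite content_cons ld_cons; case: eqP => [e|_]; last by rewrite add0r; apply: pf.
  move: ls; rewrite -e => ls _; have [_ _ /andP[_]] := place_kind0 sp (stock_kind ls).
  by rewrite addrC.
- move=> l' lK; have [e h] := pk l' lK; rewrite ld_cons wsum_cons; case: eqP => [el|nl]; last first.
    split=> [|t t0]; first by rewrite !add0r.
    by rewrite wsum_cons; case: eqP => [/nl//|_]; rewrite add0r h.
  move: (lK); rewrite -el => lK'; have [sx ox] := place_kept sp lK'.
  rewrite -el in e h *; split; first by rewrite /small_size (negbTE sx) e addrCA.
  move=> t t0; rewrite wsum_cons eqxx /small_phi (negbTE sx) -/(small_phi t).
  (* The bin was open, so its earlier small items fill less than the gap beside its first item; the
     new item adds at most 1. *)
  have h1 : wsum (small_phi t) H l <= wsum (@small_size R) H l / t.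
    rewrite /wsum mulr_suml; apply: ler_sum => y _; rewrite /small_phi /small_size.
    by case: ifP => _; [rewrite mul0r|apply: phi_le_div].
  have h2 : wsum (@small_size R) H l / t <= (1 - F`_l.2) / t.
    by rewrite ler_pM2r ?invr_gt0 //; move: ox; rewrite /is_open e; lra.
  have := phi_le1 t x; lra.
- move=> /(has_open_cons x0) ho p; rewrite inE => /orP[/eqP->|]; last exact: pko.
  case: sp {lne} => //= [l0 lx|l0 lx|n lx|n _]; rewrite ?lx // ho //.
- by move=> j jq; apply: le_trans (pw j jq) _; apply: ld_mono.
- move=> /(has_open_cons x0) ho p; rewrite inE => /orP[/eqP->|]; last exact: pso.
  by case: sp {lne} => //= [l0 _ /stock_kind->|l0 _ _ /spare_kind[->]|n _ _|l0 _ /kept_kind[->]] //; rewrite ho.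
- case: sp {lne} => [l0 _ /stock_kind k _|l0 _ _ /spare_kind[k _] _|n _ _ _ c|l0 _ /kept_kind[k _] _|n _ _ _];
    by [exact: chain2_step | exists n2; apply: chain_at_other => //=; rewrite ?k].
- case: sp {lne} => [l0 _ /stock_kind k _|l0 _ _ /spare_kind[k _] _|n _ _ _ c|l0 _ /kept_kind[k _] _|n sx _ c];
    by [exact: chain3_step | exists n3; apply: chain_at_other => //=; rewrite ?k].
- rewrite nlarge_cons big_cons.
  set c := count _ _ in pn *; set c' := count _ _.
  have cc : (c <= c')%N.
    by apply: sub_count => l'; apply: contra; apply: is_open_cons.
  have mm := matched_mono r H x l.
  set S := \sum_(j <- H | _) _ in pn *.
  have S0 : S <= (if l.1 == 2%N then (large x)%:R + S else S).
    by case: ifP => // _; rewrite lerDr ler0n.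
  (* Outside the pairs, a new large item is paid for by a newly matched stock bin or a newly covered
     spare bin. *)
  have goal k : (large x + (q + matched r H + c) <= k)%N ->
      (large x + nlarge H)%:R <= k%:R + (if l.1 == 2%N then (large x)%:R + S else S).
    rewrite -(ler_nat R) natrD => hk; rewrite natrD; lra.
  case El : l / sp => [l0 lx l0s /andP[l0h _]|l0 lx _ lW o|n lx _ _ _|l0 sx _ _|n sx _ _]; subst l.
  + by apply: goal; rewrite lx add1n -addSn -addnS; do 2?apply: leq_add => //; apply: matched_lt.
  + apply: goal; suff cl : (c < c')%N by rewrite lx add1n -addnS; do 2?apply: leq_add.
    apply: (count_lt _ lW); rewrite ?negbK //.
      by move=> l'; apply: contra; apply: is_open_cons.
    (* The first item of a spare bin and the new one both have size at least 1/2, so together they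
       cover it. *)
    have [k1 kq] := spare_kind lW; rewrite /is_open ld_cons eqxx -leNgt.
    have : 2^-1 <= ld H l0.
      by rewrite (surjective_pairing l0) k1; apply: pw; rewrite -sF.
    by move: lx; rewrite /large; lra.
  + have : (q + matched r H + c <= q + matched r ((x, (2%N, n)) :: H) + c')%N.
      by do 2?apply: leq_add.
    rewrite -(ler_nat R) => h; rewrite lx natrD /=.
    by move: pn h; set u := (_ + c)%:R; set v := (_ + c')%:R; lra.
  + by apply: goal; rewrite (negbTE sx) add0n; do 2?apply: leq_add.
  + by apply: goal; rewrite (negbTE sx) add0n; do 2?apply: leq_add.
- move=> r0 g0 p; rewrite inE => /orP[/eqP->|]; last exact: ps.
  case: sp {lne} => //= [l0 lx|l0 lx|n lx|l0 _]; rewrite ?lx //.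
  by rewrite g0 /kept take0.
Qed.

End SecondPhase.

(** * Shortage of small items *)

Section Outcome.
Context (R : realType).
Implicit Types (H : history R) (l : label) (x y t : R) (s P : seq R) (q r g n : nat).

(* [P1] is the input up to the [q]-th large item and [P2] the rest. *)
Definition bad_stock r P1 P2 : Prop :=
  (count (@large R) P2 < r)%N \/
  exists t, [/\ 0 < t <= 2^-1, \sum_(y <- P1) small_phi t y <= (2 * r)%:R
    & (count (fun y => large y && (1 - y < t)%R) P2 < r)%N].

(** The same kind of certificate for [g]: the weight counted here amounts to at most 2 per kept bin.
    Like [bad_stock], it speaks of the input only, so it can be compared with an optimal packing. *)
Definition bad_kept g P1 P2 : Prop :=
  exists t, [/\ 0 < t <= 2^-1 & \sum_(y <- P2) small_phi t y +
    \sum_(y <- P1) (if large y then 1 - phi t (1 - y) else 0) <= (2 * g)%:R].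

Lemma sub_in_count (T : eqType) (a b : pred T) (u : seq T) :
  (forall z, z \in u -> a z -> b z) -> (count a u <= count b u)%N.
Proof.
move=> h; have -> : count a u = count (predI a b) u.
  by apply: eq_in_count => z zu /=; case az: (a z) => //=; rewrite h.
by apply: sub_count => z /andP[].
Qed.

(** [t] is the least entry above [z]. It turns a bound by [z] into a strict bound by a threshold
    that is positive whenever [z] is nonnegative. *)
Lemma next_value (s : seq R) z : ~~ all (fun y => y <= z) s ->
  exists t, [/\ z < t, t \in s & forall y, y \in s -> y < t -> y <= z].
Proof.
elim: s => //= y s IH; have [yz /= /IH [t [zt ts h]]|zy _] := lerP y z.
  exists t; split=> //; first by rewrite inE ts orbT.
  by move=> y'; rewrite inE => /orP[/eqP->//|]; apply: h.
have [/allP a|/IH [t [zt ts h]]] := boolP (all (fun y => y <= z) s).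
  exists y; split=> //; first by rewrite inE eqxx.
  by move=> y'; rewrite inE => /orP[/eqP->|/a //]; rewrite ltxx.
have [yt|ty] := leP y t.
  exists y; split=> //; first by rewrite inE eqxx.
  move=> y'; rewrite inE => /orP[/eqP->|ys y'y]; first by rewrite ltxx.
  by apply: h => //; apply: lt_le_trans yt.
exists t; split=> //; first by rewrite inE ts orbT.
move=> y'; rewrite inE => /orP[/eqP->|]; last exact: h.
by move=> y't; have := lt_trans y't ty; rewrite ltxx.
Qed.

Lemma sum_unzip1 H P (F : R -> R) : perm_eq (unzip1 H) P ->
  \sum_(y <- P) F y = \sum_(p <- H) F p.1.
Proof. by move=> e; rewrite -(perm_big _ e) big_map. Qed.

Lemma small_phi_ge0 t y : 0 < t -> 0 < y -> 0 <= small_phi t y.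
Proof. by move=> t0 y0; rewrite /small_phi; case: ifP => // _; apply: phi_ge0 => //; apply: ltW. Qed.

Lemma valid_history_cat H H' : valid_history (H ++ H') = valid_history H && valid_history H'.
Proof. by rewrite /valid_history /unzip1 map_cat /valid_input all_cat. Qed.

Lemma valid_mem H p : valid_history H -> p \in H -> 0 < p.1 <= 1.
Proof. by move=> /allP vH pH; apply: vH; apply: map_f. Qed.

(** If a stock bin with load [z] after the first phase never gets a large item, fewer than [r] later
    large items have a gap of at most [z]. Take for [t] the next larger gap: no gap lies strictly
    between, and [p1_even] applies at [t] because [z] is below it. If there is no larger gap, the
    later large items themselves number fewer than [r]. *)
Lemma stock_dichotomy q r g H1 H2 P1 P2 : phase1 r H1 -> phase2 q r g H1 H2 ->
  perm_eq (unzip1 H1) P1 -> perm_eq (unzip1 H2) P2 ->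
  (forall l, l \in stock r -> 1 <= ld (H2 ++ H1) l) \/ bad_stock r P1 P2.
Proof.
move=> ph1 ph2 e1 e2; set H := H2 ++ H1.
have [am|nam] := boolP (all (fun l => has (@large R) (content H l)) (stock r)).
  by left=> l ls; apply: (p2_full ph2) => //; apply: (allP am).
right; have mr : (matched r H < r)%N.
  rewrite -{2}(size_iota 0 r) -(size_map (pair 0%N)) -/(stock r).
  by rewrite ltn_neqAle count_size andbT -all_count.
case/allPn: nam => l ls lh; have [_ cl] := p2_open ph2 ls lh.
have {cl} := leq_ltn_trans cl mr; set z := ld H1 l => cl.
have v2 : valid_history H2 by move: (p2_valid ph2); rewrite valid_history_cat => /andP[].
have z0 : 0 <= z := ld_ge0 l (p1_valid ph1).
pose s2 := [seq 1 - y | y <- unzip1 H2 & large y].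
have [a|/next_value [t [zt ts ht]]] := boolP (all (fun y => y <= z) s2).
  left; rewrite -(seq.permP e2); apply: leq_ltn_trans cl.
  have -> : count (fun y => large y && (1 <= z + y)) (unzip1 H2) = count (@large R) (unzip1 H2) => //.
  apply: eq_in_count => y yH; case ly: (large y) => //=.
  have : 1 - y \in s2 by apply: map_f; rewrite mem_filter ly.
  by move/(allP a); lra.
have t0 : 0 < t by apply: le_lt_trans zt.
right; exists t; split.
- rewrite t0 /=; case/mapP: ts => y; rewrite mem_filter => /andP[]; rewrite /large => ly _ ->; lra.
- rewrite (sum_unzip1 _ e1).
  (* A stock bin exists, so [r] is not 0 and all small items of the first phase lie in the stock. *)
  have -> : \sum_(p <- H1) small_phi t p.1 = \sum_(p <- H1 | p.2 \in stock r) small_phi t p.1.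
    rewrite [RHS]big_mkcond /= big_seq [RHS]big_seq; apply: eq_bigr => p pH.
    case: ifP => // ps; rewrite /small_phi; case: ifP => // /negbT sp.
    have [|[r0 _]] := p1_small ph1 pH sp; first by rewrite ps.
    by move: ls; rewrite r0.
  rewrite wsum_in ?stock_uniq // natrM mulrC.
  have -> : r%:R = \sum_(l' <- stock r) 1 :> R.
    by rewrite big_const_seq count_predT size_map size_iota iter_addr addr0.
  rewrite mulr_suml big_seq [leRHS]big_seq; apply: ler_sum => l' ls'.
  rewrite mul1r; apply: le_trans (small_phi_wsum _ t0 (p1_valid ph1)) _.
  by apply: (p1_even ph1 t0 ls _ ls'); apply: ltW.
- rewrite -(seq.permP e2); apply: leq_ltn_trans cl.
  apply: sub_in_count => y yH /andP[ly yt]; rewrite ly /=.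
  have : 1 - y <= z by apply: ht => //; apply: map_f; rewrite mem_filter ly.
  by lra.
Qed.

Lemma argmin_exists (s : seq nat) (F : nat -> R) : s != [::] ->
  exists2 i, i \in s & forall j, j \in s -> F i <= F j.
Proof.
elim: s => // a s IH _; case: (eqVneq s [::]) => [->|/IH [i is_ h]].
  by exists a => [|j]; rewrite inE // => /eqP->.
have [ai|ia] := leP (F a) (F i).
  exists a => [|j]; first by rewrite inE eqxx.
  by rewrite inE => /orP[/eqP->//|/h]; apply: le_trans.
exists i => [|j]; first by rewrite inE is_ orbT.
by rewrite inE => /orP[/eqP->|/h//]; apply: ltW.
Qed.

Lemma size_kept g (F : seq R) : (g <= size F)%N -> size (kept g F) = g.
Proof. by move=> gF; rewrite size_map size_takel // (perm_size (ranking_perm F)) size_iota. Qed.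

Lemma size_spare g (F : seq R) : size (spare g F) = (size F - g)%N.
Proof. by rewrite size_map size_drop (perm_size (ranking_perm F)) size_iota. Qed.

(** Let [t] be the largest gap of a kept bin. While a kept bin is open, all later small items go to
    kept bins, worth at most gap / t + 1 in each. The first item of a kept bin is worth 1 - gap / t,
    which adds up to 2. *)
Lemma kept_dichotomy q r g H1 H2 P1 P2 : phase2 q r g H1 H2 -> nlarge H1 = q ->
  (g <= q)%N -> perm_eq (unzip1 H1) P1 -> perm_eq (unzip1 H2) P2 ->
  (forall l, l \in kept g (firsts q H1) -> 1 <= ld (H2 ++ H1) l) \/ bad_kept g P1 P2.
Proof.
move=> ph nq gq e1 e2; set H := H2 ++ H1; set F := firsts q H1.
have sF : size F = q by apply: size_firsts.
have vH : valid_history H := p2_valid ph.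
have v1 : valid_history H1 by move: vH; rewrite valid_history_cat => /andP[].
have [ho|no] := boolP (has (is_open H) (kept g F)); last first.
  by left=> l lK; rewrite leNgt; apply: (hasPn no).
right; set T := take g (ranking F).
have T0 : T != [::] by move: ho; rewrite /kept -/T; case: (T).
have [i iT hi] := argmin_exists (fun j => F`_j) T0.
have FT j : j \in ranking F -> F`_j \in F by move=> /ranking_lt jF; apply: mem_nth.
have Fl j : j \in ranking F -> 2^-1 <= F`_j by move=> /FT /firsts_large.
have F1 j : j \in ranking F -> F`_j <= 1.
  move=> /FT /mem_take; rewrite mem_rev mem_filter => /andP[_ jH].
  by case/andP: (allP v1 _ jH).
set t := 1 - F`_i.
have t0 : 0 < t.
  case/hasP: ho => l lK; rewrite /is_open; have [e _] := p2_kept ph lK; rewrite e.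
  have : 0 <= wsum (@small_size R) H l.
    by apply: wsum_ge0 => // y y0; rewrite /small_size; case: ifP => // _; apply: ltW.
  case/mapP: lK => j jT -> /=; have := hi j jT; rewrite /t -/F; lra.
exists t; split.
  by rewrite t0 /t; have := Fl i (mem_take iT); lra.
rewrite (sum_unzip1 _ e2).
have -> : \sum_(y <- P1) (if large y then 1 - phi t (1 - y) else 0) =
    \sum_(j <- ranking F) (1 - phi t (1 - F`_j)).
  rewrite -(perm_big _ e1) -big_mkcond /= -big_filter -(perm_big _ (permEl (perm_rev _))).
  rewrite -(firsts_all nq) -/F (perm_big _ (ranking_perm F)) /=.
  by rewrite (big_nth 0) /index_iota subn0.
have h1 : \sum_(p <- H2) small_phi t p.1 <= \sum_(l <- kept g F) wsum (small_phi t) H l.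
  rewrite -wsum_in ?kept_uniq // /H big_cat /=.
  have h0 : 0 <= \sum_(p <- H1 | p.2 \in kept g F) small_phi t p.1.
    rewrite big_seq_cond sumr_ge0 // => p /andP[pH _]; apply: small_phi_ge0 => //.
    by case/andP: (valid_mem v1 pH).
  apply: le_trans (_ : \sum_(p <- H2 | p.2 \in kept g F) small_phi t p.1 <= _); last by rewrite lerDl.
  rewrite [leRHS]big_mkcond /= big_seq [leRHS]big_seq; apply: ler_sum => p pH.
  case: ifP => // /negbT pK; rewrite /small_phi; case: ifP => // /negbT sp.
  by rewrite (p2_kept_open ph ho pH sp) in pK.
have h2 : \sum_(l <- kept g F) wsum (small_phi t) H l <= \sum_(j <- T) ((1 - F`_j) / t + 1).
  rewrite /kept big_map big_seq [leRHS]big_seq; apply: ler_sum => j jT.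
  have [_] := @p2_kept _ _ _ _ _ _ ph (1%N, j) (map_f _ jT); exact.
(* Spare bins have gaps of at least [t], so their first items have weight 0. *)
have h3 : \sum_(j <- ranking F) (1 - phi t (1 - F`_j)) = \sum_(j <- T) (1 - (1 - F`_j) / t).
  rewrite -{1}(cat_take_drop g (ranking F)) big_cat /= [X in _ + X]big1_seq ?addr0; last first.
    move=> j /= jD; have := ranking_le iT jD => Fji.
    rewrite /phi min_l ?subrr // ler_pdivlMr // mul1r /t; lra.
  rewrite big_seq [RHS]big_seq; apply: eq_bigr => j jT; rewrite /phi min_r //.
  by rewrite ler_pdivrMr // mul1r /t; have := hi j jT; lra.
have h4 : \sum_(j <- T) ((1 - F`_j) / t + 1) + \sum_(j <- T) (1 - (1 - F`_j) / t) = (2 * g)%:R.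
  rewrite -big_split /= (eq_bigr (fun=> 2)); last by move=> j _; lra.
  rewrite big_const_seq count_predT iter_addr addr0 size_takel ?(perm_size (ranking_perm F)) ?size_iota ?sF //.
  by rewrite natrM mulr_natr.
rewrite h3; lra.
Qed.

End Outcome.

(** * Covered bins of a complete run *)

Section Covers.
Context (R : realType).
Implicit Types (H : history R) (l : label) (x y t : R) (s P : seq R) (q r g n : nat).

Definition labels q r g s : seq nat := [seq pickle l | l <- rev (unzip2 (run q r g s))].

Lemma run_rcons q r g s x :
  run q r g (rcons s x) = (x, place q r g (run q r g s) x) :: run q r g s.
Proof. by rewrite /run foldl_rcons. Qed.

Lemma unzip1_run q r g s : unzip1 (run q r g s) = rev s.
Proof.
elim/last_ind: s => // s x IH.
by rewrite run_rcons /= IH rev_rcons.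
Qed.

Lemma load_labels q r g s l : load s (labels q r g s) (pickle l) = ld (run q r g s) l.
Proof.
set H := run q r g s; rewrite /ld /wsum big_content /load.
have -> : zip s (labels q r g s) = rev [seq (p.1, pickle p.2) | p <- H].
  rewrite -{1}[s]revK -(unzip1_run q r g s) -/H /labels -/H map_rev.
  rewrite -rev_zip ?size_map //; congr rev.
  by elim: (H) => //= p H' ->.
rewrite (perm_big _ (permEl (perm_rev _))) /= big_map.
by apply: eq_bigl => p /=; rewrite (inj_eq (pcan_inj pickleK)).
Qed.

Lemma num_covered_ge q r g s (ls : seq label) : uniq ls ->
  (forall l, l \in ls -> 1 <= ld (run q r g s) l) ->
  (size ls <= num_covered s (labels q r g s))%N.
Proof.
move=> u h; rewrite /num_covered -size_filter -(size_map pickle).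
apply: uniq_leq_size; first by rewrite map_inj_uniq //; exact: (pcan_inj pickleK).
move=> j /mapP[l lls ->]; rewrite mem_filter load_labels h //= mem_undup map_f //.
by rewrite mem_rev; apply/covered_in_history/h.
Qed.

(** [P1] is the shortest prefix with [q] large items; by the last clause, each of its items arrives
    during the first phase. *)
Lemma large_split q s : (q <= count (@large R) s)%N ->
  exists P1 P2, [/\ s = P1 ++ P2, count (@large R) P1 = q &
    forall k, (k < size P1)%N -> (count (@large R) (take k P1) < q)%N].
Proof.
elim: s q => [|y s IH] [|q] //=; try by exists [::]; eexists.
case ly: (large y) => /=.
  rewrite add1n ltnS => /IH [P1 [P2 [-> c1 h]]]; exists (y :: P1), P2.
  split=> //=; first by rewrite ly c1.
  by case=> [|k] //=; rewrite ltnS ly add1n ltnS => /h.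
rewrite add0n => /IH [P1 [P2 [-> c1 h]]]; exists (y :: P1), P2.
split=> //=; first by rewrite ly c1.
by case=> [|k] //=; rewrite ltnS ly add0n => /h.
Qed.

Lemma nlarge_run q r g s : nlarge (run q r g s) = count (@large R) s.
Proof. by rewrite /nlarge unzip1_run count_rev. Qed.

Lemma phase1_run q r g P : valid_input P ->
  (forall k, (k < size P)%N -> (count (@large R) (take k P) < q)%N) ->
  phase1 r (run q r g P).
Proof.
elim/last_ind: P => [|P x IH]; first by move=> _ _; apply: phase1_nil.
rewrite /valid_input all_rcons size_rcons => /andP[xb vP] h; rewrite run_rcons.
apply: phase1_step => //.
  apply: IH => // k kP; have := h k (leqW kP).
  by rewrite -cats1 take_cat kP.
rewrite nlarge_run; have := h (size P) (leqnn _).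
by rewrite -cats1 take_size_cat.
Qed.

Lemma phase2_run q r g P1 P2 : valid_input (P1 ++ P2) -> count (@large R) P1 = q ->
  (forall k, (k < size P1)%N -> (count (@large R) (take k P1) < q)%N) ->
  exists H2, [/\ run q r g (P1 ++ P2) = H2 ++ run q r g P1, unzip1 H2 = rev P2
    & phase2 q r g (run q r g P1) H2].
Proof.
rewrite /valid_input all_cat => /andP[v1 v2] c1 h.
have nq : nlarge (run q r g P1) = q by rewrite nlarge_run.
elim/last_ind: P2 v2 => [_|P2 x IH].
  by exists [::]; rewrite cats0; split=> //; apply: phase2_start => //; apply: phase1_run.
rewrite all_rcons => /andP[xb /IH [H2 [e e2 ph]]].
exists ((x, place q r g (H2 ++ run q r g P1) x) :: H2); split.
- by rewrite -rcons_cat run_rcons e.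
- by rewrite /= e2 rev_rcons.
- exact: phase2_step.
Qed.

Lemma pairs_le H n : valid_history H -> chain_at 2 (fun y => (large y)%:R) 2 H n ->
  \sum_(p <- H | p.2.1 == 2%N) (large p.1)%:R <= (2 * n).+1%:R :> R.
Proof.
(* With [x = 1], itself large, [pair_bound] leaves room for one large item in the open bin: the
   extra unit of the bound. *)
move=> vH [_ c2 _ c4]; have := @pair_bound R H _ 1 vH c2.
have -> : large (1 : R) by rewrite /large; lra.
have -> : (2 * n).+1%:R = 2 * n%:R + 1 :> R by rewrite -[in LHS]natr1 natrM.
by move=> /= h; move: c4; lra.
Qed.

Lemma disjoint_kinds (ls1 ls2 : seq label) k1 k2 : (forall l, l \in ls1 -> l.1 = k1) ->
  (forall l, l \in ls2 -> l.1 = k2) -> k1 != k2 -> ~~ has (mem ls1) ls2.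
Proof.
move=> h1 h2 k12; apply/hasPn => l l2; apply/negP => l1.
by move: k12; rewrite -(h1 l l1) -(h2 l l2) eqxx.
Qed.

(** All stock and kept bins get covered. If a spare bin stays open there are no pairs, and apart
    from the first [q] each large item is charged to a covered bin. Otherwise all q - g spare bins
    are covered, and with [n] full pairs [C] is at least r + q + n while [L] is at most 2q - g + r +
    2n + 1. The option [g = 0] is separate because [bad_kept] may hold there. *)
Lemma reserved_outcome q r g P1 P2 : valid_input (P1 ++ P2) -> count (@large R) P1 = q ->
  (forall k, (k < size P1)%N -> (count (@large R) (take k P1) < q)%N) ->
  (g <= q)%N -> ~ bad_stock r P1 P2 -> g = 0%N \/ ~ bad_kept g P1 P2 ->
  let C := num_covered (P1 ++ P2) (labels q r g (P1 ++ P2)) in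
  let L := count (@large R) (P1 ++ P2) in
  (L <= C + q)%N \/ (L + r + g <= (2 * C).+1)%N.
Proof.
move=> v c1 h gq nbs nbk C L.
have v1 : valid_input P1 by move: v; rewrite /valid_input all_cat => /andP[].
have [H2 [eH e2 ph]] := phase2_run r g v c1 h.
set H1 := run q r g P1 in eH ph *; set F := firsts q H1.
have ph1 : phase1 r H1 by apply: phase1_run.
have nq : nlarge H1 = q by rewrite nlarge_run.
have sF : size F = q by apply: size_firsts.
have p1 : perm_eq (unzip1 H1) P1 by rewrite unzip1_run perm_rev.
have p2 : perm_eq (unzip1 H2) P2 by rewrite e2 perm_rev.
have cs : forall l, l \in stock r -> 1 <= ld (H2 ++ H1) l.
  by have [|] := stock_dichotomy ph1 ph p1 p2.
have ck : forall l, l \in kept g F -> 1 <= ld (H2 ++ H1) l.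
  case: nbk => [->|nbk]; first by rewrite /kept take0.
  by have [|] := kept_dichotomy ph nq gq p1 p2.
have vH := p2_valid ph.
have [n c2] := p2_chain2 ph.
have S2 := pairs_le vH c2.
have := p2_count ph; rewrite -/F.
set H := H2 ++ H1 in eH cs ck vH c2 S2 *.
set S := \sum_(p <- H | _) _ in S2 *; set W := count _ _ => hL.
have LE : nlarge H = L by rewrite -eH nlarge_run.
pose ls := stock r ++ (kept g F ++ ([seq l <- spare g F | ~~ is_open H l] ++ [seq (2%N, i) | i <- iota 0 n])).
have uls : uniq ls.
  have k0 : forall l, l \in stock r -> l.1 = 0%N := @stock_kind r.
  have k1 : forall l, l \in kept g F -> l.1 = 1%N by move=> l /kept_kind[].
  have k2 : forall l, l \in [seq l <- spare g F | ~~ is_open H l] -> l.1 = 1%N.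
    by move=> l; rewrite mem_filter => /andP[_ /spare_kind[]].
  have k3 : forall l, l \in [seq (2%N, i) | i <- iota 0 n] -> l.1 = 2%N by move=> l /mapP[i _ ->].
  rewrite !cat_uniq !has_cat !negb_or stock_uniq kept_uniq filter_uniq ?spare_uniq //=.
  rewrite (disjoint_kinds k0 k1) // (disjoint_kinds k0 k2) // (disjoint_kinds k0 k3) //.
  rewrite (disjoint_kinds k1 k3) // (disjoint_kinds k2 k3) //= andbT.
  apply/andP; split; last by rewrite map_inj_uniq ?iota_uniq // => i j [].
  apply/hasPn => l; rewrite mem_filter => /andP[_ lW]; apply/negP => /kept_spare.
  by rewrite lW.
have Cge : (r + g + W + n <= C)%N.
  have := @num_covered_ge q r g (P1 ++ P2) ls uls.
  rewrite !size_cat size_kept ?sF // size_filter !size_map !size_iota.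
  rewrite -/W !addnA; apply; rewrite eH => l; rewrite !mem_cat.
  case/or4P => [/cs//|/ck//||/mapP[i]].
    by rewrite mem_filter /is_open -leNgt => /andP[].
  by rewrite mem_iota /= => ni ->; case: c2 => c2 _ _ _; apply: c2.
have mr : (matched r H <= r)%N.
  by rewrite -{2}(size_iota 0 r) -(size_map (pair 0%N)) count_size.
rewrite LE in hL.
have [ho|no] := boolP (has (is_open H) (spare g F)).
  left; have S0 : S = 0.
    by rewrite /S big_seq_cond big1 // => p /andP[/(p2_spare_open ph ho) /negbTE ->].
  by rewrite S0 addr0 ler_nat in hL; lia.
right; have WE : W = (q - g)%N.
  rewrite -sF -size_spare; apply/eqP; rewrite -all_count.
  by apply/allP => l lW; rewrite (hasPn no).
have : (L <= q + matched r H + W + (2 * n).+1)%N by rewrite -(ler_nat R) natrD; lra.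
by lia.
Qed.

(** With all parameters 0 the second phase starts at once. A chain bin of small items exceeds 1 by
    less than 1/2, hence the factor 3/2. *)
Lemma unreserved_outcome s : valid_input s ->
  exists n2 n3, [/\ (n2 + n3 <= num_covered s (labels 0 0 0 s))%N,
    (count (@large R) s <= (2 * n2).+1)%N &
    \sum_(y <- s) small_size y <= 3 / 2 * n3%:R + 1].
Proof.
move=> v; have h0 k : (k < @size R [::])%N -> (count (@large R) (take k [::]) < 0)%N by [].
have [H2 [eH e2 ph]] := @phase2_run 0 0 0 [::] s v erefl h0.
rewrite /= cats0 in eH ph.
have [n2 c2] := p2_chain2 ph; have [n3 c3] := p2_chain3 ph.
have := p2_count ph; have vH := p2_valid ph; have := p2_small ph erefl erefl.
rewrite !cats0 in c2 c3 vH *.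
rewrite /spare /= add0n => hsm hL.
exists n2, n3; split.
- pose ls : seq label := [seq (2%N, i) | i <- iota 0 n2] ++ [seq (3%N, i) | i <- iota 0 n3].
  have := @num_covered_ge 0 0 0 s ls; rewrite size_cat !size_map !size_iota; apply.
    rewrite cat_uniq !map_inj_uniq ?iota_uniq //=; try by move=> i j [].
    by rewrite andbT; apply/hasPn => l /mapP[i _ ->]; apply/negP => /mapP[].
  rewrite eH => l; rewrite mem_cat => /orP[] /mapP[i]; rewrite mem_iota /= => ni ->.
    by case: c2 => c2 _ _ _; apply: c2.
  by case: c3 => c3 _ _ _; apply: c3.
- rewrite -(ler_nat R) -(count_rev (@large R)) -e2 -/(nlarge H2).
  apply: le_trans (pairs_le vH c2); move: hL.
  by rewrite /matched /= ?addn0 add0r.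
- have -> : \sum_(y <- s) small_size y = \sum_(p <- H2) small_size p.1.
    by rewrite -(big_map fst xpredT) -/(unzip1 H2) e2 (perm_big _ (permEl (perm_rev _))).
  case: c3 => _ o _ c3; apply: le_trans (_ : \sum_(p <- H2 | p.2.1 == 3%N) p.1 <= _).
    rewrite [leRHS]big_mkcond /= big_seq [leRHS]big_seq; apply: ler_sum => p pH.
    have /andP[p0 _] := valid_mem vH pH.
    rewrite /small_size; case: ifP => [_|/negbT sp]; first by case: ifP => // _; apply: ltW.
    by rewrite hsm.
  by apply: le_trans c3 _; move: o; rewrite /ld; lra.
Qed.

End Covers.

(** * Choice of the parameters and the ratio 8/15 *)

Section Choice.
Context (R : realType).
Implicit Types (x y t : R) (s P : seq R) (q r g n u : nat).

Definition large_weight t y : R := if large y then 1 - phi t (1 - y) else 0.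

Lemma weight_split t y : weight t y = small_phi t y + large_weight t y.
Proof. by rewrite /weight /small_phi /large_weight; case: ifP; rewrite ?add0r ?addr0. Qed.

Lemma large_weight_ge0 t y : 0 <= large_weight t y.
Proof. by rewrite /large_weight; case: ifP => // _; rewrite subr_ge0 phi_le1. Qed.

(** A gap of at least [t] makes [phi] equal to 1 and the large item worthless. *)
Lemma large_weight_le t y : 0 < t -> 0 < y <= 1 ->
  large_weight t y <= (large y && (1 - y < t))%:R.
Proof.
move=> t0 /andP[y0 y1]; rewrite /large_weight; case: ifP => //= _.
have [ty|yt] := leP t (1 - y) => /=.
  by rewrite /phi min_l ?subrr // ler_pdivlMr ?mul1r.
by rewrite lerBlDr lerDl phi_ge0 // subr_ge0.
Qed.

Lemma sum_small_phi_anti t1 t2 P : valid_input P -> 0 < t1 -> t1 <= t2 ->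
  \sum_(y <- P) small_phi t2 y <= \sum_(y <- P) small_phi t1 y.
Proof.
move=> /allP v t10 t12; rewrite big_seq [leRHS]big_seq; apply: ler_sum => y /v /andP[y0 _].
by rewrite /small_phi; case: ifP => // _; apply: phi_anti => //; apply: ltW.
Qed.

Lemma sum_large_weight_le t P : valid_input P -> 0 < t ->
  \sum_(y <- P) large_weight t y <= (count (fun y => large y && (1 - y < t)%R) P)%:R.
Proof.
move=> /allP v t0; rewrite count_sum big_seq [leRHS]big_seq.
by apply: ler_sum => y /v; apply: large_weight_le.
Qed.

(* Take [weight t] for the larger of the thresholds of the two shortages: [phi]
   decreases in [t], so both bounds on the small items survive. *)
Lemma shortage_bound P1 P2 n a b c r g : valid_input (P1 ++ P2) ->
  opt_profile (P1 ++ P2) n a b c -> bad_stock r P1 P2 -> bad_kept g P1 P2 ->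
  let q := count (@large R) P1 in let m := count (@large R) P2 in
  [\/ (m < r)%N, (b + 2 * c <= 3 * r + 2 * g + q)%N | (b + 2 * c <= 2 * r + 2 * g + m)%N].
Proof.
move=> v pr [mr|[t1 [/andP[t10 t12] B1 B1']]] [t2 [/andP[t20 t22] B2]] q m; first by apply: Or31.
have [v1 v2] : valid_input P1 /\ valid_input P2.
  by apply/andP; rewrite -all_cat.
have cle (t : R) P : (count (fun y => large y && (1 - y < t)%R) P <= count (@large R) P)%N.
  by apply: sub_count => y /andP[].
have W t : 0 < t <= 2^-1 -> (b + 2 * c)%:R <=
    \sum_(y <- P1) small_phi t y + \sum_(y <- P1) large_weight t y +
    (\sum_(y <- P2) small_phi t y + \sum_(y <- P2) large_weight t y).
  move=> /(profile_weight pr); rewrite big_cat /=.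
  by under eq_bigr do rewrite weight_split; under [X in _ + X]eq_bigr do rewrite weight_split; rewrite !big_split.
rewrite natrM in B1.
have B2' : \sum_(y <- P2) small_phi t2 y + \sum_(y <- P1) large_weight t2 y <= 2 * g%:R.
  by rewrite -natrM; exact: B2.
(* At [t1] the large items of [P1] cost up to [q] and those of [P2] fewer than [r]. At [t2] those of
   [P1] are already inside the 2g, and those of [P2] cost up to [m]. *)
have [t21|t12'] := leP t2 t1.
  apply: Or32; have := W t1; rewrite t10 t12 => /(_ isT).
  have := sum_small_phi_anti v2 t20 t21.
  have : 0 <= \sum_(y <- P1) large_weight t2 y by apply: sumr_ge0 => y _; apply: large_weight_ge0.
  have := sum_large_weight_le v2 t10; have := sum_large_weight_le v1 t10.
  have : (count (fun y => large y && (1 - y < t1)%R) P1)%:R <= q%:R :> R by rewrite ler_nat cle.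
  have : (count (fun y => large y && (1 - y < t1)%R) P2)%:R <= r%:R :> R by rewrite ler_nat ltnW.
  rewrite -(ler_nat R) !natrD; lra.
apply: Or33; have := W t2; rewrite t20 t22 => /(_ isT).
have := sum_small_phi_anti v1 t10 (ltW t12').
have := sum_large_weight_le v2 t20.
have : (count (fun y => large y && (1 - y < t2)%R) P2)%:R <= m%:R :> R by rewrite ler_nat cle.
rewrite -(ler_nat R) !natrD; lra.
Qed.

(** Used to stop at a multiple that works, just before one that is certified as short. *)
Lemma last_good (G : nat -> Prop) J : G 0%N ->
  exists j, [/\ (j <= J)%N, G j & j = J \/ ~ G j.+1].
Proof.
move=> G0; elim: J => [|J [j [jJ Gj [e|n]]]].
- by exists 0%N; split=> //; left.
- have [GJ|nG] := pselect (G J.+1); first by exists J.+1; split=> //; left.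
  by exists j; split=> //; [apply: leqW|right; rewrite e].
- by exists j; split=> //; [apply: leqW|right].
Qed.

(** As [L] is at least 2a + b, the third hypothesis yields b > 14a + 4c. Taking [q] near b/3
    balances the outcomes L - q and (L + q) / 2; both approach 8/15 of [N] for a = 0, L = b and c
    close to b/4. *)
Lemma cover_arith N L a b c q u r g C m : (a + b + c = N)%N -> (2 * a + b <= L)%N ->
  (15 * L + 20 * c < 16 * N)%N -> (3 * q <= b)%N -> (b < 3 * q + 3 * u)%N -> (m + q = L)%N ->
  [\/ (b <= r)%N, g = q |
    [\/ (m < r + u)%N, (b + 2 * c <= 3 * (r + u) + 2 * (g + u) + q)%N |
       (b + 2 * c <= 2 * (r + u) + 2 * (g + u) + m)%N]] ->
  (L <= C + q)%N \/ (L + r + g <= (2 * C).+1)%N ->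
  (8 * N <= 15 * C + 75 * u + 75)%N.
Proof. by move=> ? ? ? ? ? ? [?|?|[?|?|?]] [] ?; lia. Qed.

Lemma good_choice s u : valid_input s -> (0 < u)%N ->
  exists i j k, [/\ (i <= opt s %/ u + 1)%N, (j <= opt s %/ u + 1)%N, (k <= opt s %/ u + 1)%N &
   (8 * opt s <= 15 * num_covered s (labels (i * u) (j * u) (k * u) s) + 75 * u + 75)%N].
Proof.
move=> v u0; have [a [b [c pr]]] := opt_profile_exists v.
have eN := profile_bins pr; have eL := profile_large pr; have eS := profile_small pr.
set N := opt s in pr eN *; set L := count _ _ in eL.
(* In the first case, about L/2 + 2c/3 covered bins are at least 8N/15 up to a constant. *)
have [case1|case2] := leqP (16 * N) (15 * L + 20 * c).
  exists 0%N, 0%N, 0%N; split=> //.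
  have [n2 [n3 [h1 h2 h3]]] := unreserved_outcome v.
  rewrite -/L in h2; rewrite mul0n.
  have h4 : (2 * c <= 3 * n3 + 2)%N.
    by rewrite -(ler_nat R) natrD !natrM; move: (le_trans eS h3); lra.
  by move: (num_covered _ _) h1 => C h1; lia.
pose i := (b %/ (3 * u))%N; set q := (i * u)%N.
have q1 : (3 * q <= b)%N.
  by have := leq_trunc_div b (3 * u); rewrite -/i /q; lia.
have q2 : (b < 3 * q + 3 * u)%N.
  by have := ltn_ceil b (_ : 0 < 3 * u)%N; rewrite muln_gt0 u0 -/i => /(_ isT); rewrite /q; lia.
have qL : (q <= L)%N by lia.
have [P1 [P2 [es c1 hP]]] := large_split qL.
(* For [r = 0] both alternatives would require a count below 0. *)
have G0 : ~ bad_stock (0 * u) P1 P2 by rewrite mul0n; case=> // [[t []]].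
have [j [jJ Gj jn]] := @last_good (fun j => ~ bad_stock (j * u) P1 P2) (b %/ u + 1) G0.
have [k [ki Gk kn]] := @last_good (fun k => (k * u = 0)%N \/ ~ bad_kept (k * u) P1 P2) i (or_introl (mul0n u)).
have bN : (b %/ u <= N %/ u)%N by apply: leq_div2r; rewrite -eN addnAC leq_addl.
have ib : (i <= b %/ u)%N by rewrite /i leq_div2l ?muln_gt0 ?u0 // leq_pmull.
exists i, j, k.
have [iN jN kN] : [/\ (i <= N %/ u + 1)%N, (j <= N %/ u + 1)%N & (k <= N %/ u + 1)%N].
  by clear -bN ib jJ ki; split; lia.
split=> //.
have gq : (k * u <= q)%N by rewrite leq_mul2r ki orbT.
have vs : valid_input (P1 ++ P2) by rewrite -es.
have := reserved_outcome vs c1 hP gq Gj Gk; rewrite -es -/L -/q.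
move: (num_covered _ _) => C out.
have Lq : count (@large R) P2 = (L - q)%N by rewrite /L es count_cat c1 addKn.
have mL : (count (@large R) P2 + q)%N = L by rewrite Lq subnK.
apply: (cover_arith eN eL case2 q1 q2 mL) out.
(* The cap on [j] is chosen so that reaching it means [r] is at least [b]; likewise [k = i] means
   [g = q]. Below both caps, the next multiples r + u and g + u are short. *)
have [->|jne] := eqVneq j (b %/ u + 1)%N.
  by apply: Or31; rewrite addn1 ltnW // ltn_ceil.
have [->|kne] := eqVneq k i; first exact: Or32.
apply: Or33; rewrite -!mulSnr -c1.
have bs : bad_stock (j.+1 * u) P1 P2.
  by apply: contrapT; case: jn => // e; rewrite e eqxx in jne.
have bk : bad_kept (k.+1 * u) P1 P2.
  apply: contrapT => h; case: kn => [e|kn]; first by rewrite e eqxx in kne.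
  by apply: kn; right.
by rewrite es in pr; apply: shortage_bound vs pr bs bk.
Qed.

End Choice.

(** * Advice *)

Section Advice.
Context (R : realType).
Implicit Types (s past rest : seq R) (bits code : seq bool).

Definition bits_value (c : seq bool) : nat := foldr (fun (b : bool) n => (b + n.*2)%N) 0%N c.

(* The code is [1^m 0] followed by four fields of [m] bits. *)
Definition decode bits : option (nat * nat * nat * nat) :=
  let m := index false bits in
  let field i := bits_value (take m (drop (m.+1 + i * m) bits)) in
  if size bits == (5 * m).+1 then Some (field 0%N, field 1%N, field 2%N, field 3%N) else None.

(** Bits are requested until they form a complete code. Then the run is recomputed on all items
    seen, and the head of the history is the bin of the newest one. *)
Definition guided_cover : advice_algorithm R := fun seen bits =>
  if decode bits is Some (v, i, j, k) then
    PutIn (pickle (head (0%N, 0%N) (unzip2 (run (i * 2 ^ v) (j * 2 ^ v) (k * 2 ^ v) seen))))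
  else ReadBit.

Lemma bits_value_surj m n : (n < 2 ^ m)%N -> exists2 c, size c = m & bits_value c = n.
Proof.
elim: m n => [|m IH] n nm; first by exists [::] => //=; case: n nm.
have [|c sc vc] := IH n./2; first by rewrite ltn_half_double -mul2n -expnS.
by exists (odd n :: c); rewrite /= ?sc // vc odd_double_half.
Qed.

(** The code is self-delimiting: a prefix of [n] ones would need length 5n + 1, and a longer prefix
    already determines [m], hence the full length. *)
Lemma decode_code m v i j k : (v < 2 ^ m)%N -> (i < 2 ^ m)%N -> (j < 2 ^ m)%N -> (k < 2 ^ m)%N ->
  exists code, [/\ size code = (5 * m).+1, decode code = Some (v, i, j, k) &
    forall n, (n < (5 * m).+1)%N -> decode (take n code) = None].
Proof.
move=> /bits_value_surj[cv sv <-] /bits_value_surj[ci si <-].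
move=> /bits_value_surj[cj sj <-] /bits_value_surj[ck sk <-].
set w := cv ++ ci ++ cj ++ ck.
have index_ones n u : index false (nseq n true ++ false :: u) = n.
  by elim: n => //= n ->.
have index_all n : index false (nseq n true) = n by elim: n => //= n ->.
have sw : size (nseq m true ++ false :: w) = (5 * m).+1.
  by rewrite size_cat size_nseq /= !size_cat sv si sj sk; lia.
exists (nseq m true ++ false :: w); split=> //.
- have dr n : drop (m.+1 + n) (nseq m true ++ false :: w) = drop n w.
    rewrite addnC -drop_drop -cat1s catA; congr drop.
    by rewrite drop_size_cat // size_cat size_nseq addn1.
  rewrite /decode index_ones sw eqxx !dr mul0n mul1n drop0 /w.
  rewrite take_size_cat //.
  rewrite drop_size_cat // take_size_cat //.
  rewrite mul2n -addnn -drop_drop drop_size_cat // drop_size_cat // take_size_cat //.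
  rewrite (_ : (3 * m = m + (m + m))%N); last by lia.
  by rewrite addnA -!drop_drop !drop_size_cat // take_oversize ?sk.
- move=> n nm; rewrite /decode size_takel ?sw 1?ltnW //.
  case: ifP => // /eqP e; exfalso; move: e; have [nle|ngt] := leqP n m.
    rewrite takel_cat ?size_nseq // take_nseq // index_all; lia.
  rewrite take_cat size_nseq ltnNge (ltnW ngt) /= -(subnSK ngt) /= index_ones; lia.
Qed.

Lemma labels_rcons q r g s x :
  labels q r g (rcons s x) = rcons (labels q r g s) (pickle (place q r g (run q r g s) x)).
Proof. by rewrite /labels run_rcons /= rev_cons map_rcons. Qed.

Lemma exec_put_all code v i j k tape past rest :
  decode code = Some (v, i, j, k) -> mkseq tape (size code) = code ->
  let q := (i * 2 ^ v)%N in let r := (j * 2 ^ v)%N in let g := (k * 2 ^ v)%N in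
  exists bins, labels q r g (past ++ rest) = labels q r g past ++ bins /\
    exec guided_cover tape past (size code) rest bins (size code).
Proof.
move=> dc tc q r g; elim: rest past => [|x rest IH] past.
  by exists [::]; rewrite !cats0; split=> //; apply: exec_end.
have [bins [e ex]] := IH (rcons past x).
exists (pickle (place q r g (run q r g past) x) :: bins); split.
  by rewrite -cat_rcons e labels_rcons cat_rcons.
apply: exec_put ex.
by rewrite /guided_cover tc dc -/q -/r -/g run_rcons.
Qed.

(** All reading happens at the first item; the induction removes one read bit at a time, starting
    from the complete code. *)
Lemma exec_read_all code tape x past rest bins n k' : mkseq tape (size code) = code ->
  (forall n, (n < size code)%N -> decode (take n code) = None) -> (n <= size code)%N ->
  exec guided_cover tape past (size code) (x :: rest) bins k' ->
  exec guided_cover tape past n (x :: rest) bins k'.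
Proof.
move=> tc dn nc ex; rewrite -(subKn nc).
elim: (size code - n)%N (leq_subr n (size code)) => [|d IH] dc; first by rewrite subn0.
apply: exec_read; last by rewrite subnSK //; apply: IH; apply: ltnW.
have -> : mkseq tape (size code - d.+1) = take (size code - d.+1) code.
  by rewrite -{3}tc /mkseq -map_take take_iota (minn_idPl (leq_subr _ _)).
by rewrite /guided_cover dn // ltn_subrL /=; apply: leq_trans dc.
Qed.

Lemma guided_run s m v i j k :
  (v < 2 ^ m)%N -> (i < 2 ^ m)%N -> (j < 2 ^ m)%N -> (k < 2 ^ m)%N ->
  exists tape n, runs guided_cover tape s (labels (i * 2 ^ v) (j * 2 ^ v) (k * 2 ^ v) s) n /\
    (n <= (5 * m).+1)%N.
Proof.
move=> vm im jm km; have [code [sc dc dn]] := decode_code vm im jm km.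
exists (nth false code); case: s => [|x s].
  by exists 0%N; split=> //; apply: exec_end.
have tc : mkseq (nth false code) (size code) = code by apply: mkseq_nth.
exists (size code); split; last by rewrite sc.
have [bins [e ex]] := exec_put_all [::] (x :: s) dc tc.
rewrite /= in e; rewrite e; apply: exec_read_all ex => //.
by rewrite sc.
Qed.

End Advice.

(** * Growth of the advice and of the additive loss *)

Lemma opt_le_size (R : realType) (s : seq R) : (opt s <= size s)%N.
Proof.
apply/bigmax_leqP => f _; rewrite /num_covered.
by rewrite (leq_trans (count_size _ _)) // (leq_trans (size_undup _)) // size_map size_tuple.
Qed.

(* For [n = OPT], [2 ^ unit_exponent n] is about [n / log n]. *)
Definition unit_exponent (n : nat) : nat :=
  (trunc_log 2 n - trunc_log 2 (trunc_log 2 n).+1)%N.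

(** Large enough for the exponent, below log n + 1, and for the multipliers, up to n / u + 1 and
    hence of order log n. *)
Definition field_size (n : nat) : nat := (trunc_log 2 (trunc_log 2 n).+1 + 3)%N.

Lemma loglog_le n : (trunc_log 2 (trunc_log 2 n).+1 <= trunc_log 2 n)%N.
Proof.
set t := trunc_log 2 n; rewrite -{2}(trunc_expnK t (isT : 1 < 2)%N).
by apply: leq_trunc_log; apply: ltn_expl.
Qed.

Lemma field_size_mono m n : (m <= n)%N -> (field_size m <= field_size n)%N.
Proof. by move=> mn; rewrite leq_add2r leq_trunc_log // ltnS leq_trunc_log. Qed.

Lemma unit_exponent_lt n : (unit_exponent n < 2 ^ field_size n)%N.
Proof.
rewrite /unit_exponent /field_size; set t := trunc_log 2 n.
have : (t.+1 < 2 ^ (trunc_log 2 t.+1).+1)%N by apply: trunc_log_ltn.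
rewrite expnS expnD; lia.
Qed.

Lemma unit_count_lt n : (n %/ 2 ^ unit_exponent n + 1 < 2 ^ field_size n)%N.
Proof.
rewrite /unit_exponent /field_size; have := loglog_le n.
set t := trunc_log 2 n; set l := trunc_log 2 t.+1 => lt.
have h : (n %/ 2 ^ (t - l) < 2 ^ l.+1)%N.
  rewrite ltn_divLR ?expn_gt0 // -expnD addSn subnKC //.
  by apply: trunc_log_ltn.
by have := expn_gt0 2 l; move: h; rewrite expnS expnD /=; lia.
Qed.

(** The unit is at most 2n divided by log n + 1, which makes a loss of order [u] negligible against
    [n]. *)
Lemma unit_small n : (0 < n)%N -> (2 ^ unit_exponent n * (trunc_log 2 n).+1 <= 2 * n)%N.
Proof.
move=> n0; rewrite /unit_exponent; have := loglog_le n.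
set t := trunc_log 2 n; set l := trunc_log 2 t.+1 => lt.
apply: (@leq_trans (2 ^ (t - l) * 2 ^ l.+1)).
  by rewrite leq_mul2l ltnW ?orbT //; apply: trunc_log_ltn.
by rewrite -expnD addnS subnK // expnS leq_mul2l /= trunc_logP.
Qed.

Lemma ln2_ge (R : realType) : 2^-1 <= ln 2 :> R.
Proof.
(* Apply ln (1 + x) <= x at x = -1/2. *)
have h : -1 < - 2^-1 :> R by lra.
have := le_ln1Dx h; have -> : 1 + - 2^-1 = 2^-1 :> R by lra.
by rewrite lnV ?posrE //; lra.
Qed.

Lemma trunc_log_half_le (R : realType) n : (0 < n)%N -> 2^-1 * (trunc_log 2 n)%:R <= ln n%:R :> R.
Proof.
move=> n0; have h : 2%:R ^+ trunc_log 2 n <= n%:R :> R.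
  by rewrite -natrX ler_nat trunc_logP.
have p : 0 < 2%:R ^+ trunc_log 2 n :> R by apply: exprn_gt0; lra.
have := h; rewrite -ler_ln ?posrE // ?(lt_le_trans p) // lnXn; last by lra.
move=> {}h; apply: le_trans h; rewrite -[leRHS]mulr_natr ler_wpM2r //; exact: ln2_ge.
Qed.

Lemma field_size_bigO (R : realType) :
  (fun n : nat => (5 * field_size n).+1%:R : R) =O_\oo (fun n : nat => ln (ln (n%:R : R)) : R).
Proof.
apply/eqOP; near=> k; near=> n.
(* This makes Y = ln ln n at least 3. Passing from binary to natural logarithms costs a factor 2,
   and t + 1 <= (ln n)^2 another, so the advice has at most 20 Y + 16 bits, below 36 Y. *)
have nb : expR (expR 3) <= n%:R :> R by near: n; apply: nbhs_infty_ger.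
have kb : 36 <= k by near: k; apply: nbhs_pinfty_ge; rewrite num_real.
have e3 : 4 <= expR 3 :> R by have := expR_ge1Dx (3 : R); lra.
have n0 : 0 < n%:R :> R by apply: lt_le_trans nb; apply: expR_gt0.
have Xb : expR 3 <= ln n%:R :> R.
  by rewrite -(expRK (expR 3)) ler_ln ?posrE ?expR_gt0.
set X := ln n%:R in Xb *.
have X4 : 4 <= X by apply: le_trans Xb.
have Yb : 3 <= ln X by rewrite -(expRK 3) ler_ln ?posrE ?expR_gt0 //; lra.
have n1 : (0 < n)%N by rewrite -(ltr0n R).
set t := trunc_log 2 n.
have h1 : 2^-1 * t%:R <= X by apply: trunc_log_half_le.
have h2 : 2^-1 * (trunc_log 2 t.+1)%:R <= ln t.+1%:R :> R by apply: trunc_log_half_le.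
have h3 : ln t.+1%:R <= 2 * ln X.
  rewrite mulrC mulr_natr -lnXn; last by lra.
  rewrite ler_ln ?posrE ?exprn_gt0 //; last by lra.
  by rewrite -natr1 expr2; nra.
rewrite ger0_norm // ger0_norm; last by lra.
apply: (@le_trans _ _ (36 * ln X)); last by rewrite ler_wpM2r //; lra.
rewrite /field_size -/t -natr1 natrM natrD; lra.
Unshelve. all: by end_near. Qed.

Lemma unit_littleo (R : realType) :
  (fun s : seq R => 5 * (2 ^ unit_exponent (opt s))%:R + 5 : R)
    =o_ opt_oo (fun s : seq R => (opt s)%:R : R).
Proof.
apply/eqoP => eps eps0.
(* From u (k + 1) <= 2N and 20 <= eps (k + 1) follows 10 u <= eps N, and 5 u + 5 is at most 10 u. *)
set k := Num.Def.trunc (20 / eps).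
have hk : 20 / eps < k.+1%:R by apply: truncnS_gt.
exists (2 ^ k)%N => // s /= [_ Ns]; move: Ns; set N := opt s => Ns.
have N0 : (0 < N)%N by apply: leq_trans Ns; rewrite expn_gt0.
have kt : (k <= trunc_log 2 N)%N by apply: trunc_log_max.
have : (2 ^ unit_exponent N * k.+1 <= 2 * N)%N.
  by apply: leq_trans (unit_small N0); rewrite leq_mul2l ltnS kt orbT.
rewrite -(ler_nat R) !natrM; set u := (2 ^ unit_exponent N)%N => h.
have u1 : 1 <= u%:R :> R by rewrite ler1n expn_gt0.
rewrite ger0_norm; last by lra.
rewrite ger0_norm; last exact: ler0n.
have {}hk : 20 <= eps * k.+1%:R by rewrite mulrC -ler_pdivrMr // ltW.
apply: (@le_trans _ _ (10 * u%:R)); first by lra.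
have : u%:R * 20 <= u%:R * (eps * k.+1%:R) by rewrite ler_wpM2l // ler0n.
have : eps * (u%:R * k.+1%:R) <= eps * (2 * N%:R) by rewrite ler_wpM2l // ltW.
by rewrite mulrCA; lra.
Qed.

Theorem theorem3 (R : realType) :
  exists (A : advice_algorithm R) (s : nat -> nat) (b : seq R -> R),
    [/\ (fun n : nat => (s n)%:R : R) =O_\oo
          (fun n : nat => ln (ln (n%:R : R)) : R),
        b =o_ opt_oo (fun sigma : seq R => (opt sigma)%:R : R)
      & forall (n : nat) (sigma : seq R),
          (size sigma <= n)%N -> valid_input sigma ->
          exists (tape : nat -> bool) (bins : seq nat) (k : nat),
            [/\ runs A tape sigma bins k,
                (k <= s n)%N
              & 8 / 15 * (opt sigma)%:R - b sigma
                  <= (num_covered sigma bins)%:R]].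
Proof.
exists (@guided_cover R), (fun n => (5 * field_size n).+1),
  (fun s => 5 * (2 ^ unit_exponent (opt s))%:R + 5).
split; [exact: field_size_bigO|exact: unit_littleo|move=> n sigma sn vs].
set e := unit_exponent (opt sigma); set m := field_size (opt sigma).
have [|i [j [k [ib jb kb good]]]] := @good_choice R sigma (2 ^ e) vs; first by rewrite expn_gt0.
have lt x : (x <= opt sigma %/ 2 ^ e + 1)%N -> (x < 2 ^ m)%N.
  by move=> /leq_ltn_trans; apply; apply: unit_count_lt.
have [tape [bits [runs_ok bits_le]]] :=
  guided_run sigma (unit_exponent_lt _) (lt i ib) (lt j jb) (lt k kb).
exists tape, (labels (i * 2 ^ e) (j * 2 ^ e) (k * 2 ^ e) sigma), bits; split=> //.
  (* The fields are sized by OPT, which is at most the length of the input and so at most [n]. *)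
  apply: leq_trans bits_le _; rewrite ltnS leq_mul2l /=; apply: field_size_mono.
  by apply: leq_trans sn; apply: opt_le_size.
(* Dividing the bound of [good_choice] by 15 turns 75 u + 75 into the additive term 5 u + 5. *)
move: good; rewrite -(ler_nat R) natrD [X in _ <= X + _]natrD !natrM.
by set C := (num_covered _ _)%:R; set u := (2 ^ e)%:R; set N := (opt sigma)%:R; lra.
Qed.
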